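(* Let $X^{f}$ be a $\ast\ast$-closed superreflexive class of finite equivalence, let $E_X\in X^{f}$ be the separable space of almost universal disposition with respect to $\mathfrak{M}(X^{f})$, and let $(E_X)^{\ast}$ be its conjugate. Then $(E_X)^{\ast}$ is almost cohomogeneous.
   Context: Finite representability: for Banach spaces $X,Y$, $X<_f Y$ means that for every $\varepsilon>0$ and every finite dimensional subspace $A$ of $X$ there are a subspace $B$ of $Y$ and an isomorphism $u:A\to B$ with $\|u\|\,\|u^{-1}\|\le 1+\varepsilon$. $X\sim_f Y$ means $X<_fY$ and $Y<_fX$; the class of finite equivalence of $X$ is $X^{f}=\{Y: X\sim_f Y\}$. The class $X^f$ is superreflexive if every space in it is reflexive. Minkowski's base: $\mathfrak{M}$ is the set of all finite dimensional Banach spaces (isometric spaces identified), the disjoint union over $n$ of the sets $\mathfrak{M}_n$ of $n$-dimensional spaces, each with the metric $\log d$, $d$ the Banach–Mazur distance. $H(X)\subseteq\mathfrak{M}$ is the set of finite dimensional subspaces of $X$, and $\mathfrak{M}(X^{f})$ is the closure of $H(X)$ in $\mathfrak{M}$. It depends only on $X^{f}$ and determines $X^{f}$. Operations: for $K\subseteq\mathfrak{M}$, $H(K)$ is the set of all subspaces of members of $K$, $Q(K)$ is the set of all quotients of members of $K$, and $HQ(K)=H(Q(K))$. Let $l_2(X)$ be the $l_2$-sum of countably many copies of $X$ and $\mathsf{D}_2(X^{f})=(l_2(X))^{f}$. The class $\ast\ast(X^{f})$ is the class $W^{f}$ with $\mathfrak{M}(W^{f})=HQ\,\mathfrak{M}(\mathsf{D}_2(X^{f}))$.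 A class $X^{f}$ is $\ast\ast$-closed if $X^{f}=\ast\ast(W^{f})$ for some Banach space $W$. Almost universal disposition: a Banach space $E$ is of almost universal disposition with respect to a class $\mathcal{K}$ of Banach spaces if for all $A,B\in\mathcal{K}$ with $A$ a subspace of $B$, every $\varepsilon>0$ and every isomorphic embedding $i:A\to E$ there is an isomorphic embedding $\hat\imath:B\to E$ with $\hat\imath|_A=i$ and $\|\hat\imath\|\,\|\hat\imath^{-1}\|\le(1+\varepsilon)\|i\|\,\|i^{-1}\|$ (inverses taken on the images). Almost cohomogeneity: a Banach space $V$ is almost cohomogeneous if for every $\varepsilon>0$ and every pair of isometric finite dimensional quotients $V/Y$ and $V/Z$, with isometry $i:V/Y\to V/Z$, there is an automorphism (linear isomorphism onto) $I:V\to V$ with $\|I\|\,\|I^{-1}\|\le1+\varepsilon$ and $i\circ h_Y=h_Z\circ I$, where $h_Y:V\to V/Y$ and $h_Z:V\to V/Z$ are the quotient maps. *)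

(* Defs.v *)
From HB Require Import structures.
From mathcomp Require Import all_boot all_order all_algebra.
From mathcomp Require Import all_classical all_reals all_analysis.
From mathcomp Require Import ring.

Set Implicit Arguments.
Unset Strict Implicit.
Unset Printing Implicit Defensive.

Import Order.TTheory GRing.Theory Num.Theory.
Import numFieldNormedType.Exports.

Local Open Scope classical_set_scope.
Local Open Scope ring_scope.

Section operator_norm.
Context {R : realType}.
Implicit Types V W : normedModType R.
Local Open Scope ereal_scope.

Definition opnorm V W (u : V -> W) : \bar R :=
  ereal_sup [set `|u x|%:E | x in [set x : V | (`|x| <= 1)%R]].

(* The norm of the inverse u(V) -> V of an injective linear map u: the unit   *)
(* ball of the image u(V) is enumerated by the x such that |u x| <= 1.        *)
Definition inv_opnorm V W (u : V -> W) : \bar R :=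
  ereal_sup [set `|x|%:E | x in [set x : V | (`|u x| <= 1)%R]].

Definition distortion V W (u : V -> W) : \bar R := opnorm u * inv_opnorm u.

Definition iso_embedding V W (u : {linear V -> W}) : Prop :=
  [/\ injective u, opnorm u < +oo & inv_opnorm u < +oo].

Definition isomorphism V W (u : {linear V -> W}) : Prop :=
  [/\ bijective u, opnorm u < +oo & inv_opnorm u < +oo].

Definition isometry V W (u : {linear V -> W}) : Prop :=
  bijective u /\ forall x, `|u x|%R = `|x|%R.

Definition isometric V W : Prop := exists u : {linear V -> W}, isometry u.

Lemma opnorm_ge0 V W (u : V -> W) : 0 <= opnorm u.
Proof.
apply: (@le_trans _ _ `|u 0%R|%:E); first by rewrite lee_fin.
by apply: ereal_sup_ubound; exists 0%R => //=; rewrite normr0.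
Qed.

Lemma opnorm_leP V W (u : V -> W) (M : R) : linear u -> (0 <= M)%R ->
  opnorm u <= M%:E <-> (forall x, `|u x| <= M * `|x|)%R.
Proof.
move=> lu M0.
have u0 : u 0%R = 0%R.
  by have := lu (-1)%R 0%R 0%R; rewrite scaler0 addr0 scaleN1r addNr.
have uZ (a : R) x : u (a *: x)%R = (a *: u x)%R.
  by have := lu a x 0%R; rewrite addr0 u0 addr0.
split=> [uM x|uM]; last first.
  apply: ub_ereal_sup => _ [x /= x1 <-]; rewrite lee_fin.
  by rewrite (le_trans (uM x))// ler_piMr.
have [->|x0] := eqVneq x 0%R.
  by rewrite u0 !normr0 mulr0.
have nx : (0 < `|x|)%R by rewrite normr_gt0.
have : (`|u (`|x|^-1 *: x)|)%:E <= M%:E.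
  apply: le_trans uM; apply: ereal_sup_ubound; exists (`|x|^-1 *: x)%R => //=.
  by rewrite normfZV.
by rewrite lee_fin uZ normrZ normfV normr_id ler_pdivrMl// mulrC.
Qed.

Lemma opnorm_ltyP V W (u : V -> W) : linear u ->
  opnorm u < +oo <-> exists M, (forall x, `|u x| <= M * `|x|)%R.
Proof.
move=> lu; split=> [uoo|[M uM]].
  exists (fine (opnorm u)); apply/(opnorm_leP lu); first exact/fine_ge0/opnorm_ge0.
  by rewrite fineK// ge0_fin_numE// opnorm_ge0.
have M0 : (0 <= Num.max M 0)%R by rewrite le_max lexx orbT.
apply: (@le_lt_trans _ _ (Num.max M 0)%:E); last exact: ltry.
apply/(opnorm_leP lu M0) => x; rewrite (le_trans (uM x))// ler_wpM2r//.
by rewrite le_max lexx.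
Qed.

End operator_norm.

Definition finite_dim {R : realType} (V : normedModType R) : Prop :=
  exists (n : nat) (e : 'I_n -> V),
    forall x, exists c : 'I_n -> R, x = \sum_i c i *: e i.

Definition separable {R : realType} (V : normedModType R) : Prop :=
  exists D : set V, countable D /\ dense D.

Section subspace.
Context {R : realType} {V : normedModType R} (S : submodClosed V).

Definition subsp : Type := {x : V | x \in S}.

HB.instance Definition _ := SubChoice.on subsp.
HB.instance Definition _ := [SubChoice_isSubLmodule of subsp by <:].

Definition subsp_norm (x : subsp) : R := `|val x|.

Lemma subsp_normD x y : subsp_norm (x + y) <= subsp_norm x + subsp_norm y.
Proof. by rewrite /subsp_norm raddfD ler_normD. Qed.

Lemma subsp_normZ (a : R) x : subsp_norm (a *: x) = `|a| * subsp_norm x.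
Proof. by rewrite /subsp_norm linearZ normrZ. Qed.

Lemma subsp_norm0 x : subsp_norm x = 0 -> x = 0.
Proof. by move=> /normr0_eq0 x0; apply/val_inj; rewrite raddf0. Qed.

HB.instance Definition _ :=
  Lmodule_isNormed.Build R subsp subsp_normD subsp_normZ subsp_norm0.

End subspace.

Record closedSubmod {R : realType} (V : normedModType R) := ClosedSubmod {
  closedSubmod_pred :> {pred V};
  closedSubmod_submod : submod_closed closedSubmod_pred;
  closedSubmod_closed : closed [set x : V | x \in closedSubmod_pred]
}.

Section quotient.
Context {R : realType} {V : normedModType R} (Y : closedSubmod V).
Local Open Scope quotient_scope.

HB.instance Definition _ := GRing.isSubmodClosed.Build R V
  (closedSubmod_pred Y) (GRing.submod_closed_semi (closedSubmod_submod Y)).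

Definition quotsp : Type := @Quotient.quot V (closedSubmod_pred Y).

HB.instance Definition _ := GRing.Zmodule.on quotsp.

Definition quot_map (x : V) : quotsp := \pi_(@Quotient.quot V (closedSubmod_pred Y)) x.

Lemma quot_mapP x y :
  quot_map x = quot_map y <-> x - y \in Y.
Proof.
by rewrite /quot_map; split=> [/eqP|h]; [|apply/eqP]; rewrite -Quotient.idealrBE.
Qed.

Lemma quot_map_surj q : exists x, quot_map x = q.
Proof. by exists (repr q); rewrite /quot_map reprK. Qed.

Lemma quot_mapD x y : quot_map (x + y) = quot_map x + quot_map y.
Proof. by rewrite /quot_map Quotient.pi_add. Qed.

Definition quot_scale (a : R) (q : quotsp) : quotsp := quot_map (a *: repr q).

Lemma quot_mapZ a x : quot_map (a *: x) = quot_scale a (quot_map x).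
Proof.
apply/quot_mapP; rewrite -scalerBr; apply: rpredZ.
by apply/quot_mapP; rewrite [RHS]/quot_map reprK.
Qed.

Lemma quot_scalerA a b q : quot_scale a (quot_scale b q) = quot_scale (a * b) q.
Proof. by have [x <-] := quot_map_surj q; rewrite -!quot_mapZ scalerA. Qed.

Lemma quot_scale1r : left_id 1 quot_scale.
Proof. by move=> q; have [x <-] := quot_map_surj q; rewrite -quot_mapZ scale1r. Qed.

Lemma quot_scalerDr : right_distributive quot_scale +%R.
Proof.
move=> a p q; have [x <-] := quot_map_surj p; have [y <-] := quot_map_surj q.
by rewrite -quot_mapD -!quot_mapZ -quot_mapD scalerDr.
Qed.

Lemma quot_scalerDl q : {morph quot_scale^~ q : a b / a + b}.
Proof.
move=> a b; have [x <-] := quot_map_surj q.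
by rewrite -!quot_mapZ -quot_mapD scalerDl.
Qed.

HB.instance Definition _ := GRing.Zmodule_isLmodule.Build R quotsp
  quot_scalerA quot_scale1r quot_scalerDr quot_scalerDl.

Lemma quot_map_is_linear : linear quot_map.
Proof. by move=> a x y; rewrite quot_mapD quot_mapZ. Qed.

HB.instance Definition _ :=
  GRing.isLinear.Build R V quotsp *:%R quot_map quot_map_is_linear.

Definition quot_norm (q : quotsp) : R :=
  inf [set `|x| | x in [set x : V | quot_map x = q]].

Lemma quot_norm_has_inf q :
  has_inf [set `|x| | x in [set x : V | quot_map x = q]].
Proof.
split; last by exists 0 => _ [x _ <-].
by have [x xq] := quot_map_surj q; exists `|x|; exists x.
Qed.

Lemma quot_norm_le x : quot_norm (quot_map x) <= `|x|.
Proof. by apply: ge_inf; [case: (quot_norm_has_inf (quot_map x))|exists x]. Qed.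

Lemma quot_norm_ge0 q : 0 <= quot_norm q.
Proof.
by apply: lb_le_inf; [case: (quot_norm_has_inf q)|move=> _ [x _ <-]].
Qed.

Lemma quot_norm_adherent (e : R) q : 0 < e ->
  exists2 x, quot_map x = q & `|x| < quot_norm q + e.
Proof.
move=> e0; have [_ [x xq <-]] := inf_adherent e0 (quot_norm_has_inf q).
by exists x.
Qed.

Lemma quot_normD p q : quot_norm (p + q) <= quot_norm p + quot_norm q.
Proof.
apply/ler_addgt0Pr => e e0.
have e20 : 0 < e / 2 by rewrite divr_gt0.
have [x <- px] := quot_norm_adherent p e20.
have [y <- qy] := quot_norm_adherent q e20.
rewrite -quot_mapD (le_trans (quot_norm_le _))// (le_trans (ler_normD _ _))//.
by rewrite [e]splitr addrACA; apply: lerD; exact: ltW.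
Qed.

Lemma quot_normZ_le (a : R) q : quot_norm (a *: q) <= `|a| * quot_norm q.
Proof.
have [->|a0] := eqVneq a 0.
  by rewrite scale0r normr0 mul0r -(linear0 quot_map) -[leRHS](@normr0 _ V) quot_norm_le.
have na0 : 0 < `|a| by rewrite normr_gt0.
apply/ler_addgt0Pr => e e0.
have [x <- xq] := quot_norm_adherent q (divr_gt0 e0 na0).
rewrite -linearZ (le_trans (quot_norm_le _))// normrZ.
by rewrite -(divfK (lt0r_neq0 na0) e) [_ * `|a|]mulrC -mulrDr ler_wpM2l// ltW.
Qed.

Lemma quot_normZ (a : R) q : quot_norm (a *: q) = `|a| * quot_norm q.
Proof.
apply/eqP; rewrite eq_le quot_normZ_le/=.
have [->|a0] := eqVneq a 0; first by rewrite normr0 mul0r quot_norm_ge0.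
have := quot_normZ_le a^-1 (a *: q).
by rewrite scalerA mulVf// scale1r normfV ler_pdivlMl// normr_gt0.
Qed.

Lemma quot_norm0 q : quot_norm q = 0 -> q = 0.
Proof.
have [x <-] := quot_map_surj q => x0.
rewrite -(linear0 quot_map); apply/quot_mapP; rewrite subr0.
apply: (closedSubmod_closed) => A /nbhs_ballP[e /= e0 xA].
have [y yx] := quot_norm_adherent (quot_map x) e0; rewrite x0 add0r => ye.
exists (x - y); split; first exact/quot_mapP.
by apply: xA; rewrite -ball_normE/= opprB addrC subrK.
Qed.

HB.instance Definition _ :=
  Lmodule_isNormed.Build R quotsp quot_normD quot_normZ quot_norm0.

End quotient.


Section dual.
Context {R : realType} (V : normedModType R).

Definition dual_pred : {pred V -> R^o} :=
  [pred f : V -> R^o | `[< linear f /\ (opnorm f < +oo)%E >]].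

Lemma dual_submod_closed : submod_closed dual_pred.
Proof.
split.
  have l0 : linear (0 : V -> R^o) by move=> a x y; rewrite scaler0 addr0.
  rewrite inE/=; split => //; apply/(opnorm_ltyP l0).
  by exists 0 => x; rewrite mul0r normr0.
move=> a f g; rewrite !inE/= => -[lf foo] [lg goo].
have lfg : linear (a *: f + g).
  move=> b x y; rewrite /= !fctE lf lg !scalerDr !scalerA [b * a]mulrC.
  by rewrite !addrA; congr (_ + _); rewrite -!addrA; congr (_ + _); rewrite addrC.
split => //; apply/(opnorm_ltyP lfg).
have /(opnorm_ltyP lf)[M fM] := foo; have /(opnorm_ltyP lg)[N gN] := goo.
exists (`|a| * M + N) => x; rewrite (le_trans (ler_normD _ _))// mulrDl lerD//.
by rewrite normrZ -mulrA ler_wpM2l.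
Qed.

HB.instance Definition _ := GRing.isSubmodClosed.Build R (V -> R^o) dual_pred
  (GRing.submod_closed_semi dual_submod_closed).

Definition dual : Type := {f : V -> R^o | f \in dual_pred}.

HB.instance Definition _ := SubChoice.on dual.
HB.instance Definition _ := [SubChoice_isSubLmodule of dual by <:].

Definition dual_fun (f : dual) : V -> R^o := val f.
Coercion dual_fun : dual >-> Funclass.

Lemma dual_linear (f : dual) : linear (dual_fun f).
Proof. by have := valP f; rewrite inE/= => -[]. Qed.

Lemma dual_opnorm_lty (f : dual) : (opnorm (dual_fun f) < +oo)%E.
Proof. by have := valP f; rewrite inE/= => -[]. Qed.

HB.instance Definition _ (f : dual) :=
  GRing.isLinear.Build R V R^o *:%R (dual_fun f) (dual_linear f).

Definition dual_norm (f : dual) : R := fine (opnorm (dual_fun f)).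

Lemma dual_norm_ge0 (f : dual) : 0 <= dual_norm f.
Proof. exact/fine_ge0/opnorm_ge0. Qed.

Lemma dual_norm_leP (f : dual) (M : R) : 0 <= M ->
  dual_norm f <= M <-> forall x, `|f x| <= M * `|x|.
Proof.
move=> M0; rewrite -(opnorm_leP (dual_linear f) M0) -lee_fin fineK//.
by rewrite ge0_fin_numE ?opnorm_ge0 ?dual_opnorm_lty.
Qed.

Lemma dual_norm_le (f : dual) x : `|f x| <= dual_norm f * `|x|.
Proof. by move: x; apply/dual_norm_leP => //; exact: dual_norm_ge0. Qed.

Lemma dual_normD (f g : dual) : dual_norm (f + g) <= dual_norm f + dual_norm g.
Proof.
apply/dual_norm_leP; first by rewrite addr_ge0 ?dual_norm_ge0.
move=> x; rewrite mulrDl (le_trans (ler_normD _ _))// lerD//; exact: dual_norm_le.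
Qed.

Lemma dual_normZ_le (a : R) (f : dual) : dual_norm (a *: f) <= `|a| * dual_norm f.
Proof.
apply/dual_norm_leP; first by rewrite mulr_ge0 ?dual_norm_ge0.
by move=> x; rewrite normrZ -mulrA ler_wpM2l// dual_norm_le.
Qed.

Lemma dual_normZ (a : R) (f : dual) : dual_norm (a *: f) = `|a| * dual_norm f.
Proof.
apply/eqP; rewrite eq_le dual_normZ_le/=.
have [->|a0] := eqVneq a 0; first by rewrite normr0 mul0r dual_norm_ge0.
have := dual_normZ_le a^-1 (a *: f).
by rewrite scalerA mulVf// scale1r normfV ler_pdivlMl// normr_gt0.
Qed.

Lemma dual_norm0 (f : dual) : dual_norm f = 0 -> f = 0.
Proof.
move=> f0; apply/val_inj/funext => x; apply/eqP; rewrite -normr_le0.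
by rewrite (le_trans (dual_norm_le f x))// f0 mul0r.
Qed.

HB.instance Definition _ :=
  Lmodule_isNormed.Build R dual dual_normD dual_normZ dual_norm0.

Lemma dual_complete (F : set_system dual) : ProperFilter F -> cauchy F -> cvg F.
Proof.
move=> FF /cauchy_ballP Fc.
have Fx x : cvg ((fun f : dual => (f x : R^o)) @ F).
  apply: cauchy_cvg; apply/cauchy_ballP => e e0.
  have e1 : 0 < e / (`|x| + 1) by rewrite divr_gt0// ltr_wpDl.
  have [[A B] [/= FA FB] AB] := Fc _ e1.
  exists ((fun f : dual => (f x : R^o)) @` A, (fun f : dual => (f x : R^o)) @` B).
    by split; [apply: filterS FA|apply: filterS FB] => f Af /=; exists f.
  move=> [_ _] [/= [f Af <-] [g Bg <-]].
  have := AB (f, g) (conj Af Bg); rewrite -!ball_normE/= => fg.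
  rewrite -[_ - _]/(dual_fun (f - g) x) (le_lt_trans (dual_norm_le _ _))//.
  have x1 : 0 < `|x| + 1 by rewrite ltr_wpDl.
  move: fg; rewrite ltr_pdivlMr//; apply: le_lt_trans.
  by rewrite ler_wpM2l ?lerDl// dual_norm_ge0.
pose g x : R^o := lim ((fun f : dual => (f x : R^o)) @ F).
have gl : linear g.
  move=> a x y; apply: cvg_lim => //.
  rewrite [X in X @ _](_ : _ = fun f : dual => a *: (f x : R^o) + f y); last first.
    by apply/funext => f; rewrite linearP.
  by apply: cvgD; [apply: cvgZl_tmp; exact: Fx|exact: Fx].
have approx (e : R) : 0 < e -> F [set f : dual | forall x, `|dual_fun f x - g x| <= e * `|x|].
  move=> e0; have [[A B] [/= FA FB] AB] := Fc _ e0.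
  apply: filterS FA => f Af x.
  have lim1 : (fun h : dual => `|dual_fun f x - (h x : R^o)|) @ F --> `|dual_fun f x - g x|.
    by apply: cvg_norm; apply: cvgB; [exact: cvg_cst|exact: Fx].
  rewrite -(cvg_lim (@Rhausdorff R) lim1); apply: limr_le; first by apply/cvg_ex; eexists; exact: lim1.
  apply: filterS FB => h Bh; have := AB (f, h) (conj Af Bh).
  rewrite -ball_normE/= => /ltW fh.
  by rewrite -[_ - _]/(dual_fun (f - h) x) (le_trans (dual_norm_le _ _))// ler_wpM2r.
have gd : g \in dual_pred.
  rewrite inE/=; split => //; apply/(opnorm_ltyP gl).
  have [f fg] := filter_ex (approx 1 ltr01).
  exists (1 + dual_norm f) => x; rewrite mulrDl.
  rewrite -[g x](subrK (dual_fun f x)) (le_trans (ler_normD _ _))// lerD// ?dual_norm_le//.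
  by rewrite distrC.
apply/cvg_ex; exists (exist _ g gd : dual).
apply/cvgrPdist_le => e e0; apply: filterS (approx e e0) => f fg.
rewrite distrC; apply/dual_norm_leP; first exact: ltW.
by move=> x; exact: fg.
Qed.

HB.instance Definition _ := Uniform_isComplete.Build dual dual_complete.

End dual.

Section l2_sum.
Context {R : realType} (X : normedModType R).
Implicit Types (x y : nat -> X) (n : nat).

Definition sq_norms x : R^nat := fun n => `|x n| ^+ 2.

Definition l2_pred : {pred nat -> X} :=
  [pred x : nat -> X | `[< cvgn (series (sq_norms x)) >]].

Lemma sq_norms_ge0 x n : 0 <= sq_norms x n.
Proof. exact: exprn_ge0. Qed.

Lemma series_sq_norms_ge0 x n : 0 <= series (sq_norms x) n.
Proof. by apply: sumr_ge0 => k _; exact: sq_norms_ge0. Qed.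

Lemma series_sq_norms_ndecr x : nondecreasing_seq (series (sq_norms x)).
Proof. by apply/nondecreasing_series => k _ _; exact: sq_norms_ge0. Qed.

Definition l2_norm_upto n x : R := Num.sqrt (series (sq_norms x) n).

Lemma plane_minkowski (A B a b : R) : 0 <= A -> 0 <= B -> 0 <= a -> 0 <= b ->
  Num.sqrt ((A + B) ^+ 2 + (a + b) ^+ 2) <=
  Num.sqrt (A ^+ 2 + a ^+ 2) + Num.sqrt (B ^+ 2 + b ^+ 2).
Proof.
move=> A0 B0 a0 b0.
set s := Num.sqrt (A ^+ 2 + a ^+ 2); set t := Num.sqrt (B ^+ 2 + b ^+ 2).
have s0 : 0 <= s by exact: sqrtr_ge0.
have t0 : 0 <= t by exact: sqrtr_ge0.
have s2 : s ^+ 2 = A ^+ 2 + a ^+ 2 by rewrite sqr_sqrtr// addr_ge0 ?sqr_ge0.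
have t2 : t ^+ 2 = B ^+ 2 + b ^+ 2 by rewrite sqr_sqrtr// addr_ge0 ?sqr_ge0.
rewrite -(ler_pXn2r (ltn0Sn 1)) ?nnegrE ?sqrtr_ge0 ?addr_ge0//.
rewrite sqr_sqrtr; last by rewrite addr_ge0 ?sqr_ge0.
have CS : A * B + a * b <= s * t.
  rewrite -(ler_pXn2r (ltn0Sn 1)) ?nnegrE ?mulr_ge0 ?addr_ge0 ?mulr_ge0//.
  rewrite exprMn s2 t2 -subr_ge0.
  have -> : (A ^+ 2 + a ^+ 2) * (B ^+ 2 + b ^+ 2) - (A * B + a * b) ^+ 2
     = (A * b - a * B) ^+ 2 by ring.
  exact: sqr_ge0.
rewrite [(s + t) ^+ 2]sqrrD s2 t2 -subr_ge0.
have -> : A ^+ 2 + a ^+ 2 + s * t *+ 2 + (B ^+ 2 + b ^+ 2) -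
  ((A + B) ^+ 2 + (a + b) ^+ 2) = (s * t - (A * B + a * b)) *+ 2 by ring.
by rewrite mulrn_wge0// subr_ge0.
Qed.

Lemma l2_norm_uptoD n x y :
  l2_norm_upto n (x + y) <= l2_norm_upto n x + l2_norm_upto n y.
Proof.
elim: n => [|n IHn]; rewrite /l2_norm_upto.
  by rewrite /series/= !big_geq// sqrtr0 addr0.
have sq z : series (sq_norms z) n.+1 = l2_norm_upto n z ^+ 2 + `|z n| ^+ 2.
  by rewrite seriesSr /l2_norm_upto sqr_sqrtr// series_sq_norms_ge0.
rewrite !sq.
apply: le_trans (plane_minkowski _ _ _ _); rewrite ?sqrtr_ge0//.
rewrite ler_wsqrtr// lerD// ler_pXn2r ?nnegrE ?addr_ge0 ?sqrtr_ge0//.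
exact: ler_normD.
Qed.

Lemma l2_norm_uptoZ n (a : R) x :
  l2_norm_upto n (a *: x) = `|a| * l2_norm_upto n x.
Proof.
rewrite /l2_norm_upto -sqrtr_sqr -sqrtrM ?sqr_ge0//; congr Num.sqrt.
rewrite /series/= mulr_sumr; apply: eq_bigr => k _.
by rewrite /sq_norms fctE normrZ exprMn real_normK// num_real.
Qed.

Definition l2_fun_norm x : R := Num.sqrt (limn (series (sq_norms x))).

Lemma l2_fun_normP x (M : R) : 0 <= M ->
  (x \in l2_pred /\ l2_fun_norm x <= M) <-> (forall n, l2_norm_upto n x <= M).
Proof.
move=> M0; split=> [[+ xM n]|xM].
  rewrite inE/= => cx; apply: le_trans xM; rewrite ler_wsqrtr//.
  exact: (nondecreasing_cvgn_le (@series_sq_norms_ndecr x)).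
have xM2 n : series (sq_norms x) n <= M ^+ 2.
  rewrite -[leLHS](sqr_sqrtr (series_sq_norms_ge0 x n)).
  by rewrite ler_pXn2r ?nnegrE ?sqrtr_ge0//; exact: xM.
have cx : cvgn (series (sq_norms x)).
  apply: nondecreasing_is_cvgn; first exact: series_sq_norms_ndecr.
  by exists (M ^+ 2) => _ [n _ <-].
split; first by rewrite inE.
rewrite -[leRHS](ger0_norm M0) -sqrtr_sqr ler_wsqrtr//.
by apply: limr_le => //; exact: nearW.
Qed.

Lemma l2_fun_norm_ge0 x : 0 <= l2_fun_norm x.
Proof. exact: sqrtr_ge0. Qed.

Lemma l2_norm_upto_le n x : x \in l2_pred -> l2_norm_upto n x <= l2_fun_norm x.
Proof.
by move=> xl; move: n; apply/l2_fun_normP; rewrite ?l2_fun_norm_ge0.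
Qed.

Lemma l2_submod_closed : submod_closed l2_pred.
Proof.
split.
  apply: (proj1 (proj2 (l2_fun_normP 0 (lexx 0)) _)) => n.
  by rewrite -(scale0r (0 : nat -> X)) l2_norm_uptoZ normr0 mul0r.
move=> a x y xl yl.
have M0 : 0 <= `|a| * l2_fun_norm x + l2_fun_norm y.
  by rewrite addr_ge0 ?mulr_ge0 ?l2_fun_norm_ge0.
apply: (proj1 (proj2 (l2_fun_normP _ M0) _)) => n.
rewrite (le_trans (l2_norm_uptoD _ _ _))// l2_norm_uptoZ.
by rewrite lerD ?ler_wpM2l ?l2_norm_upto_le.
Qed.

HB.instance Definition _ := GRing.isSubmodClosed.Build R (nat -> X) l2_pred
  (GRing.submod_closed_semi l2_submod_closed).

Definition l2_sum : Type := {x : nat -> X | x \in l2_pred}.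

HB.instance Definition _ := SubChoice.on l2_sum.
HB.instance Definition _ := [SubChoice_isSubLmodule of l2_sum by <:].

Definition l2_norm (x : l2_sum) : R := l2_fun_norm (val x).

Lemma l2_norm_leP (x : l2_sum) (M : R) : 0 <= M ->
  l2_norm x <= M <-> (forall n, l2_norm_upto n (val x) <= M).
Proof.
by move=> M0; rewrite -(l2_fun_normP _ M0); split=> [xM|[]//]; split=> //; exact: valP.
Qed.

Lemma l2_normD (x y : l2_sum) : l2_norm (x + y) <= l2_norm x + l2_norm y.
Proof.
apply/l2_norm_leP => [|n]; first by rewrite addr_ge0 ?l2_fun_norm_ge0.
apply: le_trans (l2_norm_uptoD _ _ _) _.
by apply: lerD; apply: l2_norm_upto_le; exact: valP.
Qed.

Lemma l2_normZ_le (a : R) (x : l2_sum) : l2_norm (a *: x) <= `|a| * l2_norm x.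
Proof.
apply/l2_norm_leP => [|n]; first by rewrite mulr_ge0 ?l2_fun_norm_ge0.
by rewrite l2_norm_uptoZ ler_wpM2l//; apply: l2_norm_upto_le; exact: valP.
Qed.

Lemma l2_normZ (a : R) (x : l2_sum) : l2_norm (a *: x) = `|a| * l2_norm x.
Proof.
apply/eqP; rewrite eq_le l2_normZ_le/=.
have [->|a0] := eqVneq a 0; first by rewrite normr0 mul0r l2_fun_norm_ge0.
have := l2_normZ_le a^-1 (a *: x).
by rewrite scalerA mulVf// scale1r normfV ler_pdivlMl// normr_gt0.
Qed.

Lemma l2_coord_le (x : l2_sum) n : `|val x n| <= l2_norm x.
Proof.
rewrite -[leLHS]normr_id -sqrtr_sqr (le_trans _ (l2_norm_upto_le n.+1 (valP x)))//.
by rewrite ler_wsqrtr// seriesSr lerDr series_sq_norms_ge0.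
Qed.

Lemma l2_norm0 (x : l2_sum) : l2_norm x = 0 -> x = 0.
Proof.
move=> x0; apply/val_inj/funext => n; apply/eqP; rewrite -normr_le0 -x0.
exact: l2_coord_le.
Qed.

HB.instance Definition _ :=
  Lmodule_isNormed.Build R l2_sum l2_normD l2_normZ l2_norm0.

End l2_sum.

Section l2_sum_complete.
Context {R : realType} (X : completeNormedModType R).

Lemma l2_sum_complete (F : set_system (l2_sum X)) :
  ProperFilter F -> cauchy F -> cvg F.
Proof.
move=> FF /cauchy_ballP Fc.
have Fx n : cvg ((fun x : l2_sum X => val x n) @ F).
  apply: cauchy_cvg; apply/cauchy_ballP => e e0.
  have [[A B] [/= FA FB] AB] := Fc _ e0.
  exists ((fun x : l2_sum X => val x n) @` A, (fun x : l2_sum X => val x n) @` B).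
    by split; [apply: filterS FA|apply: filterS FB] => x Ax /=; exists x.
  move=> [_ _] [/= [x Ax <-] [y By <-]].
  have := AB (x, y) (conj Ax By); rewrite -!ball_normE/= => xy.
  by rewrite -[_ - _]/(val (x - y) n) (le_lt_trans (l2_coord_le _ _)).
pose g n : X := lim ((fun x : l2_sum X => val x n) @ F).
have approx (e : R) : 0 < e ->
    F [set x : l2_sum X | forall n, l2_norm_upto n (val x - g) <= e].
  move=> e0; have [[A B] [/= FA FB] AB] := Fc _ e0.
  apply: filterS FA => x Ax n.
  have lim1 m : (fun y : l2_sum X => series (sq_norms (val x - val y)) m) @ F -->
                series (sq_norms (val x - g)) m.
    elim: m => [|m IHm].
      have s0 z : series (@sq_norms R X z) 0%N = 0 by rewrite /series/= big_geq.
      by rewrite s0; under eq_cvg do rewrite s0; exact: cvg_cst.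
    rewrite seriesSr; under eq_cvg do rewrite seriesSr.
    apply: cvgD => //.
    have Fxm : (fun y : l2_sum X => `|val x m - val y m|) @ F --> `|val x m - g m|.
      by apply: cvg_norm; apply: cvgB; [exact: cvg_cst|exact: Fx].
    exact: (cvgM Fxm Fxm).
  rewrite /l2_norm_upto -(ger0_norm (ltW e0)) -sqrtr_sqr ler_wsqrtr//.
  rewrite -(cvg_lim (@Rhausdorff R) (lim1 n)).
  apply: limr_le; first by apply/cvg_ex; eexists; exact: lim1.
  apply: filterS FB => y By; have := AB (x, y) (conj Ax By).
  rewrite -ball_normE/= => /ltW xy.
  have : l2_norm_upto n (val (x - y)) <= e.
    by apply: le_trans xy; apply: l2_norm_upto_le; exact: valP.
  rewrite -(ler_pXn2r (ltn0Sn 1)) ?nnegrE ?sqrtr_ge0 ?(ltW e0)//.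
  by rewrite sqr_sqrtr// series_sq_norms_ge0.
have gd : g \in @l2_pred R X.
  have [x xg] := filter_ex (approx 1 ltr01).
  rewrite -[g](subKr (val x)); apply: rpredB; first exact: valP.
  exact: (proj1 (proj2 (l2_fun_normP _ ler01) xg)).
apply/cvg_ex; exists (exist _ g gd : l2_sum X).
apply/cvgrPdist_le => e e0; apply: filterS (approx e e0) => x xg.
by rewrite distrC; apply/l2_norm_leP => //; exact: ltW.
Qed.

HB.instance Definition _ := Uniform_isComplete.Build (l2_sum X) l2_sum_complete.

End l2_sum_complete.

Section finite_equivalence.
Context {R : realType}.
Implicit Types X Y E W : completeNormedModType R.

Definition finitely_representable X Y : Prop :=
  forall e : R, 0 < e ->
  forall A : submodClosed X, finite_dim (subsp A) ->
  exists (B : submodClosed Y) (u : {linear subsp A -> subsp B}),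
    isomorphism u /\ (distortion u <= (1 + e)%:E)%E.

Definition finitely_equivalent X Y : Prop :=
  finitely_representable X Y /\ finitely_representable Y X.

Definition fclass X : completeNormedModType R -> Prop :=
  fun Y => finitely_equivalent X Y.

Definition reflexive_space X : Prop :=
  forall phi : dual (dual X), exists x : X,
    forall f : dual X, dual_fun phi f = dual_fun f x.

Definition superreflexive X : Prop :=
  forall Y, fclass X Y -> reflexive_space Y.

End finite_equivalence.

(* Sets of finite dimensional spaces up to isometry are predicates on         *)
(* normedModType R; completeness is automatic in finite dimension. Membership *)
(* "up to isometry" is built into subspaces_of and quotients.                 *)
Section minkowski.
Context {R : realType}.
Implicit Types (A B V : normedModType R) (K : normedModType R -> Prop).

(* Only dimensions n >= 1 are considered: the map of the zero space has norm  *)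
(* 0, so d(0, 0) and the distortion of an embedding of 0 would be 0 and not 1.*)
Definition minkowski_space : normedModType R -> Prop :=
  fun A => finite_dim A /\ exists x : A, x != 0.

(* +oo when A and B are not isomorphic, i.e. have different dimensions.       *)
Definition banach_mazur A B : \bar R :=
  ereal_inf [set distortion u | u in [set u : {linear A -> B} | isomorphism u]].

Definition minkowski_closure K : normedModType R -> Prop :=
  fun A => minkowski_space A /\
    forall e : R, 0 < e -> exists B, K B /\ (lne (banach_mazur A B) < e%:E)%E.

Definition subspaces_of V : normedModType R -> Prop :=
  fun A => minkowski_space A /\
    exists S : submodClosed V, isometric A (subsp S).

Definition subspaces K : normedModType R -> Prop :=
  fun A => exists B, K B /\ subspaces_of B A.

Definition quotients K : normedModType R -> Prop :=
  fun A => minkowski_space A /\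
    exists B, K B /\ exists Z : closedSubmod B, isometric A (quotsp Z).

(* Depends on V only through its class of finite equivalence, and determines  *)
(* that class; operations on classes are therefore given on representatives.  *)
Definition minkowski_base V : normedModType R -> Prop :=
  minkowski_closure (subspaces_of V).

End minkowski.

Section disposition.
Context {R : realType}.
Implicit Types X E W V : completeNormedModType R.

Definition starstar W : completeNormedModType R -> Prop :=
  fun V => forall A, minkowski_base V A <->
    subspaces (quotients (minkowski_base (l2_sum W))) A.

Definition starstar_closed X : Prop :=
  exists W, forall Y, fclass X Y <-> starstar W Y.

Definition almost_universal_disposition E (K : normedModType R -> Prop) : Prop :=
  forall (B : normedModType R) (A : submodClosed B), K B -> K (subsp A) ->
  forall (e : R) (i : {linear subsp A -> E}), 0 < e -> iso_embedding i ->
  exists j : {linear B -> E},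
    [/\ iso_embedding j,
        forall a : subsp A, j (val a) = i a
      & (distortion j <= (1 + e)%:E * distortion i)%E].

Definition almost_cohomogeneous V : Prop :=
  forall (e : R) (Y Z : closedSubmod V), 0 < e ->
  finite_dim (quotsp Y) -> finite_dim (quotsp Z) ->
  forall i : {linear quotsp Y -> quotsp Z}, isometry i ->
  exists I : {linear V -> V},
    [/\ isomorphism I,
        (distortion I <= (1 + e)%:E)%E
      & forall x, i (quot_map Y x) = quot_map Z (I x)].

End disposition.

(* Main.v *)
Require Import Defs.
From HB Require Import structures.
From mathcomp Require Import all_boot all_order all_algebra.
From mathcomp Require Import all_classical all_reals all_analysis.
From mathcomp Require Import ring lra.

Set Implicit Arguments.
Unset Strict Implicit.
Unset Printing Implicit Defensive.

Import Order.TTheory GRing.Theory Num.Theory.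
Import numFieldNormedType.Exports.

(* Since E is reflexive, an isometry E*/Y -> E*/Z between finite dimensional  *)
(* quotients is the adjoint of an isometry from the annihilator of Z in E     *)
(* onto that of Y. Every finite dimensional subspace of E belongs to the      *)
(* Minkowski base of X^f, so almost universal disposition allows a            *)
(* back-and-forth along a dense sequence of E, each step extending the        *)
(* previous partial isomorphism exactly and keeping its distortion below      *)
(* 1 + e. The closure of the union of the graphs is the graph of an           *)
(* automorphism T of E that extends the isometry, and its adjoint is the      *)
(* required automorphism of E*.                                               *)

Local Open Scope classical_set_scope.
Local Open Scope ring_scope.

(** The automorphism of [dual E] is the adjoint [f |-> f o T] of an automorphism [T] of [E]. That it
    induces [i] on the quotients can be tested on the annihilator of [Z] in [E]: by reflexivity, a
    functional vanishing there lies in [Z] ([bipolar]). On that annihilator the requirement is that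
    [T] extend the isometry predual to [i]. Its graph, [predual_graph], is isometric
    ([predual_graph_norm]), is defined on the whole annihilator ([predual_graph_total]) and is
    finite dimensional ([predual_graph_spanned]).

    The extension [T] comes from [back_and_forth]. Almost universal disposition adjoins one vector
    to the domain of a finite dimensional partial isomorphism, at the cost of a factor [1 + e] with
    [e] as small as desired ([extend_domain]); transposing the graph does the same for the range.
    Partial isomorphisms are handled as linear subsets of [E * E] obeying the inequality
    [distorted], so that inverses, unions and closures need no change of domain type;
    [automorphism_of_dense_graph] takes the limit. *)

Section linear_sets.
Context {R : realType}.
Implicit Types V W : lmodType R.

(** * Linear sets, graphs and finite spans *)

Definition linear_set V (S : set V) : Prop :=
  S 0 /\ forall (a : R) x y, S x -> S y -> S (a *: x + y).

Lemma linear_setZ V (S : set V) a x : linear_set S -> S x -> S (a *: x).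
Proof. by move=> [S0 SP] Sx; rewrite -[_ *: _]addr0; exact: SP. Qed.

Lemma linear_setD V (S : set V) x y : linear_set S -> S x -> S y -> S (x + y).
Proof. by move=> [S0 SP] Sx Sy; rewrite -[x]scale1r; exact: SP. Qed.

Lemma linear_setB V (S : set V) x y : linear_set S -> S x -> S y -> S (x - y).
Proof. by move=> [S0 SP] Sx Sy; rewrite addrC -scaleN1r; exact: SP. Qed.

Definition mk_linear V W (f : V -> W) (lf : linear f) : {linear V -> W} :=
  HB.pack f (GRing.isLinear.Build R V W *:%R f lf).

(** Any choice of values is linear: its defect of linearity is a value of [G] over 0, hence 0. *)
Lemma linear_of_graph V W (G : set (V * W)) : linear_set G ->
  (forall y, G (0, y) -> y = 0) -> (forall x, exists y, G (x, y)) ->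
  exists u : {linear V -> W}, forall x, G (x, u x).
Proof.
move=> [G0 GP] Gfun /choice[f Gf].
have Glin : linear_set G by split.
have lf : linear f.
  move=> a x y; apply/eqP; rewrite -subr_eq0; apply/eqP/Gfun.
  have := linear_setB Glin (Gf (a *: x + y)) (GP a _ _ (Gf x) (Gf y)).
  by congr (G _); congr pair; rewrite /= subrr.
by exists (mk_linear lf).
Qed.

Fixpoint lspan V (s : seq V) : set V :=
  if s is v :: s' then [set x | exists a y, lspan s' y /\ x = a *: v + y]
  else [set 0].

Lemma lspan_linear V (s : seq V) : linear_set (lspan s).
Proof.
elim: s => [|v s [s0 IHs]]; split=> //=.
- by move=> a x y -> ->; rewrite scaler0 addr0.
- by exists 0, 0; rewrite scale0r addr0.
move=> a _ _ [b [x [sx ->]]] [c [y [sy ->]]].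
exists (a * b + c), (a *: x + y); split; first exact: IHs.
by rewrite scalerDr scalerA scalerDl addrACA.
Qed.

Lemma lspan_behead V (v : V) s : lspan s `<=` lspan (v :: s).
Proof. by move=> x sx; exists 0, x; rewrite scale0r add0r. Qed.

Lemma lspan_head V (v : V) s : lspan (v :: s) v.
Proof.
exists 1, 0; rewrite scale1r addr0; split => //.
by case: (lspan_linear s).
Qed.

Lemma lspan_map V W (u : {linear V -> W}) s :
  lspan (map u s) = u @` lspan s.
Proof.
elim: s => [|v s IHs] /=.
  by rewrite image_set1 linear0.
rewrite IHs; apply/seteqP; split=> x /=.
  move=> [a [_ [[y sy <-] ->]]]; exists (a *: v + y); last by rewrite linearP.
  by exists a, y.
move=> [_ [a [y [sy ->]]] <-]; exists a, (u y); split; first by exists y.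
by rewrite linearP.
Qed.

(** Finitely many functionals separating the points of [S] bound its dimension: each of them either
    vanishes on [S] or splits off one vector [b] from its kernel in [S]. *)
Lemma lspan_of_functionals V (I : eqType) (r : seq I) (g : I -> V -> R)
    (S : set V) :
  (forall i a x y, g i (a *: x + y) = a * g i x + g i y) -> linear_set S ->
  (forall x, S x -> (forall i, i \in r -> g i x = 0) -> x = 0) ->
  exists s, lspan s = S.
Proof.
move=> gP; elim: r S => [|i r IHr] S [S0 SP] Sinj.
  exists [::]; apply/seteqP; split=> x /=; first by move=> ->.
  by move=> Sx; apply: Sinj.
have g0 j : g j 0 = 0.
  by have := gP j (-1) 0 0; rewrite scaler0 addr0 mulN1r addNr.
have [all0|/existsNP[b /not_implyP[Sb /eqP gb]]] :=
    pselect (forall x, S x -> g i x = 0).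
  apply: IHr => // x Sx xr; apply: Sinj => // j; rewrite inE => /predU1P[->|/xr//].
  exact: all0.
have [|x [Sx gx] xr|s sE] := IHr (S `&` [set x | g i x = 0]).
- split=> [|a x y [Sx xi] [Sy yi]]; first by split; [|exact: g0].
  split; first exact: SP.
  by rewrite /= gP xi yi mulr0 addr0.
- by apply: Sinj => // j; rewrite inE => /predU1P[->|/xr].
exists (b :: s); rewrite /= sE; apply/seteqP; split=> x /=.
  by move=> [a [y [[Sy _] ->]]]; exact: SP.
move=> Sx; exists (g i x / g i b), (- (g i x / g i b) *: b + x).
split; last by rewrite scaleNr addrA subrr add0r.
split; first exact: SP.
by rewrite /= gP mulNr divfK// addNr.
Qed.

End linear_sets.

(** * The Hahn-Banach theorem *)

Section hahn_banach.
Context {R : realType} {V : normedModType R}.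

Definition dominated (G : set (V * R^o)) : Prop :=
  forall p, G p -> (p.2 : R) <= `|p.1|.

(** The admissible values at [x] lie above every [q.2 - |q.1 - x|] and below every
    [|q.1 + x| - q.2]. The triangle inequality puts the former below the latter, so the supremum of
    the former is admissible. *)
Lemma dominated_extension (G : set (V * R^o)) x :
  linear_set G -> dominated G ->
  exists t, dominated [set p | exists q a, G q /\ p = a *: (x, t) + q].
Proof.
move=> Gl Gd.
pose L := [set (q.2 : R) - `|q.1 - x| | q in G].
have key p q : G p -> G q -> (p.2 : R) - `|p.1 - x| <= `|q.1 + x| - q.2.
  move=> Gp Gq; have /Gd /= h := linear_setD Gl Gp Gq.
  have := ler_normD (p.1 - x) (q.1 + x).
  rewrite addrACA addNr addr0 => h'; have := le_trans h h'; lra.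
have G0 : G 0 by case: Gl.
have supL : has_sup L.
  split; first by exists ((0 : V * R^o).2 - `|(0 : V * R^o).1 - x|), 0.
  by exists (`|(0 : V * R^o).1 + x| - (0 : V * R^o).2) => _ [p Gp <-]; exact: key.
exists (sup L) => p [q [a [Gq ->]]] /=.
have low p0 : G p0 -> (p0.2 : R) - `|p0.1 - x| <= sup L.
  by move=> Gp0; apply: ub_le_sup; [case: supL|exists p0].
have upp p0 : G p0 -> sup L <= `|p0.1 + x| - p0.2.
  move=> Gp0; apply: ge_sup; first by case: supL.
  by move=> _ [p' Gp' <-]; exact: key.
(* Dividing by [|a|] reduces a negative coefficient to [low] and a positive one to [upp]. *)
have [a0|a0|->] := ltgtP a 0.
- have na : 0 < (- a)^-1 by rewrite invr_gt0 oppr_gt0.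
  have : (- a)^-1 * (q.2 : R) - `|(- a)^-1 *: q.1 - x| <= sup L.
    exact: low (linear_setZ (- a)^-1 Gl Gq).
  have -> : (- a)^-1 *: q.1 - x = (- a)^-1 *: (a *: x + q.1).
    by rewrite scalerDr scalerA invrN mulNr mulVf ?lt_eqF// scaleN1r addrC.
  rewrite normrZ gtr0_norm// -mulrBr -ler_pdivlMl// invrK => h.
  by rewrite -[a *: sup L]/(a * sup L); lra.
- have ia : 0 < a^-1 by rewrite invr_gt0.
  have : sup L <= `|a^-1 *: q.1 + x| - a^-1 * (q.2 : R).
    exact: upp (linear_setZ a^-1 Gl Gq).
  have -> : a^-1 *: q.1 + x = a^-1 *: (a *: x + q.1).
    by rewrite scalerDr scalerA mulVf ?gt_eqF// scale1r addrC.
  rewrite normrZ gtr0_norm// -mulrBr -ler_pdivrMl// invrK => h.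
  by rewrite -[a *: sup L]/(a * sup L); lra.
by rewrite !scale0r !add0r; exact: Gd.
Qed.

(** Zorn's lemma gives a maximal dominated linear graph through [(v, |v|)]; [dominated_extension]
    shows that its domain is all of [V]. *)
Lemma norming_functional (v : V) :
  exists f : dual V, dual_fun f v = `|v| /\ forall x, `|dual_fun f x| <= `|x|.
Proof.
have normalize (G : set (V * R^o)) : linear_set G -> dominated G ->
    forall p, G p -> `|p.2 : R| <= `|p.1|.
  move=> Gl Gd p Gp; rewrite ler_norml Gd// andbT lerNl.
  by have := Gd _ (linear_setZ (-1) Gl Gp); rewrite /= !scaleN1r normrN.
(* [Zorn_bigcup] includes the empty chain, so the empty set must satisfy P *)
pose P (G : set (V * R^o)) := [/\ forall p q a, G p -> G q -> G (a *: p + q),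
  dominated G & forall p, G p -> G (v, `|v|)].
have P_linear G p : P G -> G p -> linear_set G.
  move=> [GP _ _] Gp; split=> [|a x y]; last exact: GP.
  by have := GP _ _ (-1) Gp Gp; rewrite scaleN1r addNr.
have [F FP Ftot|G [PG Gmax]] := @Zorn_bigcup _ P.
  split.
  - move=> p q a [A FA Ap] [B FB Bq].
    have [AB|BA] := Ftot _ _ FA FB.
      by exists B => //; have [BP _ _] := FP _ FB; apply: BP => //; exact: AB.
    by exists A => //; have [AP _ _] := FP _ FA; apply: AP => //; exact: BA.
  - by move=> p [A FA Ap]; have [_ Ad _] := FP _ FA; exact: Ad.
  - by move=> p [A FA Ap]; have [_ _ Av] := FP _ FA; exists A => //; exact: Av Ap.
have Gv : G (v, `|v|).
  have [[p Gp]|G0] := pselect (exists p, G p).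
    by case: PG => _ _; apply; exact: Gp.
  exfalso; apply: (Gmax [set a *: (v, `|v| : R^o) | a in setT]).
    split; last first.
      move=> /(_ (v, `|v|)) h; apply: G0; exists (v, `|v|); apply: h.
      by exists 1; rewrite ?scale1r.
    by move=> p Gp; exfalso; apply: G0; exists p.
  split.
  - move=> _ _ a [b _ <-] [c _ <-]; exists (a * b + c) => //.
    by rewrite scalerDl scalerA.
  - by move=> _ [a _ <-] /=; rewrite normrZ ler_wpM2r// ler_norm.
  - by move=> _ _; exists 1; rewrite ?scale1r.
have Gl := P_linear _ _ PG Gv.
have [GP Gd _] := PG.
have Gtot x : exists t, G (x, t).
  have [t Dt] := dominated_extension x Gl Gd.
  exists t; apply: contrapT => nGx.
  set G' := (X in dominated X) in Dt.
  have GG' : G `<=` G' by move=> p Gp; exists p, 0; rewrite scale0r add0r.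
  apply: (Gmax G').
    split=> // G'G; apply: nGx; apply: G'G; exists 0, 1.
    by rewrite scale1r addr0; split => //; case: Gl.
  split => //; last by move=> _ _; exact: GG'.
  move=> _ _ a [p [b [Gp ->]]] [q [c [Gq ->]]].
  exists (a *: p + q), (a * b + c); split; first exact: GP.
  by rewrite scalerDr scalerA scalerDl addrACA.
have [|f Gf] := linear_of_graph Gl _ Gtot.
  move=> y /(normalize _ Gl Gd) /=; rewrite normr0 normr_le0 => /eqP//.
have fb x : `|f x| <= `|x| by exact: (normalize _ Gl Gd _ (Gf x)).
have fd : (f : V -> R^o) \in @dual_pred R V.
  rewrite inE/=; split; first exact: linearP.
  apply/opnorm_ltyP; first exact: linearP.
  by exists 1 => x; rewrite mul1r.
exists (exist _ (f : V -> R^o) fd : dual V); split => //=.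
rewrite /dual_fun /=.
have /(normalize _ Gl Gd) /= := linear_setB Gl (Gf v) Gv.
by rewrite subrr normr0 normr_le0 subr_eq0 => /eqP.
Qed.

End hahn_banach.

(** * Distortion and two-sided norm bounds *)

Section distortion_bounds.
Context {R : realType} {V W : normedModType R}.
Implicit Types (u : {linear V -> W}) (a b M : R).

Lemma inv_opnorm_ge0 (u : V -> W) : u 0 = 0 -> (0 <= inv_opnorm u)%E.
Proof.
move=> u0; apply: (@le_trans _ _ `|0 : V|%:E); first by rewrite lee_fin.
by apply: ereal_sup_ubound; exists 0 => //=; rewrite u0 normr0.
Qed.

Lemma opnorm_finP u x : (opnorm u < +oo)%E -> `|u x| <= fine (opnorm u) * `|x|.
Proof.
move=> uoo; move: x; apply/(opnorm_leP (linearP u)); first exact/fine_ge0/opnorm_ge0.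
by rewrite fineK// ge0_fin_numE// opnorm_ge0.
Qed.

Lemma inv_opnorm_finP u x : injective u -> (inv_opnorm u < +oo)%E ->
  `|x| <= fine (inv_opnorm u) * `|u x|.
Proof.
move=> uI uoo; have i0 := inv_opnorm_ge0 (linear0 u).
have [->|x0] := eqVneq x 0; first by rewrite linear0 !normr0 mulr0.
have ux : 0 < `|u x|.
  by rewrite normr_gt0; apply: contra_neq x0 => ux0; apply: uI; rewrite ux0 linear0.
have : (`|(`|u x|^-1 *: x)|%:E <= inv_opnorm u)%E.
  apply: ereal_sup_ubound; exists (`|u x|^-1 *: x) => //=.
  by rewrite linearZ normfZV// -normr_gt0.
rewrite -(@fineK _ (inv_opnorm u)) ?ge0_fin_numE// lee_fin.
by rewrite normrZ normfV normr_id ler_pdivrMl// mulrC.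
Qed.

Lemma bounded_distortion u a b : 0 <= a -> 0 <= b ->
  (forall x, `|u x| <= a * `|x|) -> (forall x, `|x| <= b * `|u x|) ->
  [/\ (opnorm u < +oo)%E, (inv_opnorm u < +oo)%E
    & (distortion u <= (a * b)%:E)%E].
Proof.
move=> a0 b0 ua ub.
have oa : (opnorm u <= a%:E)%E by apply/(opnorm_leP (linearP u)).
have ob : (inv_opnorm u <= b%:E)%E.
  apply: ub_ereal_sup => _ [x /= x1 <-]; rewrite lee_fin (le_trans (ub x))//.
  by rewrite ler_piMr.
split; [exact: le_lt_trans oa (ltry _)|exact: le_lt_trans ob (ltry _)|].
rewrite EFinM; apply: lee_pmul => //; first exact: opnorm_ge0.
exact/inv_opnorm_ge0/linear0.
Qed.

Lemma distortion_bound u M : iso_embedding u -> (distortion u <= M%:E)%E ->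
  forall x y, `|u x| * `|y| <= M * (`|x| * `|u y|).
Proof.
move=> [uI uo io] uM x y.
have o0 := opnorm_ge0 u; have i0 := inv_opnorm_ge0 (linear0 u).
have : fine (opnorm u) * fine (inv_opnorm u) <= M.
  by rewrite -lee_fin EFinM !fineK ?ge0_fin_numE.
have := opnorm_finP x uo; have := inv_opnorm_finP y uI io => yb xa h.
apply: (le_trans (ler_pM _ _ xa yb)) => //.
by rewrite mulrACA ler_wpM2r// mulr_ge0.
Qed.

(** The product inequality fixes the two constants only up to a scaling: [a] is the operator norm,
    positive because [u x0] is nonzero, and [b] is [M / a]. *)
Lemma bounds_of_distortion u M (x0 : V) : x0 != 0 -> u x0 != 0 ->
  (forall x y, `|u x| * `|y| <= M * (`|x| * `|u y|)) ->
  exists a b, [/\ 0 <= a, 0 <= b, a * b <= M,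
    forall x, `|u x| <= a * `|x| & forall x, `|x| <= b * `|u x|].
Proof.
move=> x00 ux00 uM.
have nx0 : 0 < `|x0| by rewrite normr_gt0.
have nu0 : 0 < `|u x0| by rewrite normr_gt0.
have M0 : 0 <= M.
  have p := mulr_gt0 nx0 nu0; rewrite -(pmulr_lge0 _ p).
  by apply: le_trans (uM x0 x0); rewrite mulr_ge0.
have bnd y x : y != 0 -> `|u x| <= M * `|u y| / `|y| * `|x|.
  move=> y0; have := uM x y; rewrite -ler_pdivlMr ?normr_gt0// => /le_trans; apply.
  lra.
have uoo : (opnorm u < +oo)%E.
  by apply/(opnorm_ltyP (linearP u)); eexists => x; exact: bnd x00.
pose a := fine (opnorm u).
have ua x : `|u x| <= a * `|x| by exact: opnorm_finP.
have a0 : 0 < a by rewrite -(pmulr_lgt0 _ nx0) (lt_le_trans nu0).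
exists a, (M / a); split => //; [exact: ltW|by rewrite divr_ge0// ltW| |].
  by rewrite mulrC divfK ?gt_eqF.
move=> y; have [->|y0] := eqVneq y 0; first by rewrite linear0 !normr0 mulr0.
have ny : 0 < `|y| by rewrite normr_gt0.
rewrite mulrAC ler_pdivlMr// mulrC -ler_pdivlMr// -lee_fin fineK; last first.
  by rewrite ge0_fin_numE// opnorm_ge0.
apply/(opnorm_leP (linearP u)); last by move=> x; exact: bnd.
by rewrite divr_ge0// mulr_ge0.
Qed.

End distortion_bounds.

(** * Finite dimensional subspaces and the Minkowski base *)

Section finite_dimension.
Context {R : realType}.
Implicit Types V W : normedModType R.

Lemma finite_dim_lspan V (s : seq V) : (forall x, lspan s x) -> finite_dim V.
Proof.
move=> sV; exists (size s), (fun i => nth 0 s i) => x.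
elim: s x {sV}(sV x) => [|v s IHs] x /=.
  by move=> ->; exists (fun=> 0); rewrite big_ord0.
move=> [a [y [/IHs[c ->] ->]]].
exists (fun i => if unlift ord0 i is Some j then c j else a).
rewrite big_ord_recl unlift_none/=; congr (_ + _).
by apply: eq_bigr => i _; rewrite liftK.
Qed.

Lemma finite_dim_image V W (u : {linear V -> W}) :
  (forall y, exists x, u x = y) -> finite_dim V -> finite_dim W.
Proof.
move=> usurj [n [e eV]]; exists n, (u \o e) => y.
have [x <-] := usurj y; have [c ->] := eV x; exists c.
by rewrite linear_sum; apply: eq_bigr => i _; rewrite linearZ.
Qed.

End finite_dimension.

Section set_subspace.
Context {R : realType} {V : normedModType R}.

Record linsub := LinSub { linsub_set :> set V; linsubP : linear_set linsub_set }.

Definition linsub_pred (S : linsub) : {pred V} := [pred x | `[< linsub_set S x >]].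

Lemma linsub_closed (S : linsub) : submod_closed (linsub_pred S).
Proof.
have [S0 SP] := linsubP S; split; first by rewrite inE/=.
by move=> a x y; rewrite !inE/= => Sx Sy; exact: SP.
Qed.

HB.instance Definition _ (S : linsub) := GRing.isSubmodClosed.Build R V
  (linsub_pred S) (GRing.submod_closed_semi (linsub_closed S)).

Definition linsub_submod (S : linsub) : submodClosed V := linsub_pred S.

Lemma linsubE S x : (x \in linsub_submod S) = `[< linsub_set S x >].
Proof. by []. Qed.

End set_subspace.

Section minkowski_base_embedding.
Context {R : realType}.
Implicit Types (A V W : normedModType R) (X E : completeNormedModType R).

Lemma isometric_refl A : isometric A A.
Proof.
by exists (@idfun A : {linear A -> A}); split => //; exists id.
Qed.

(** Finite representability sends the isometric image of [A] in [E] into [X] with distortion at most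
    [1 + e], so [A] is a limit of subspaces of [X]. *)
Lemma minkowski_base_embedding X E A (u : {linear A -> E}) :
  finitely_representable E X -> minkowski_space A ->
  (forall x, `|u x| = `|x|) -> minkowski_base X A.
Proof.
move=> EX mA uiso; split => // e e0.
have uI : injective u.
  move=> x y uxy; apply/eqP; rewrite -subr_eq0 -normr_eq0 -uiso linearB uxy.
  by rewrite subrr normr0.
have Slin : linear_set (range u).
  split; first by exists 0; rewrite ?linear0.
  by move=> a _ _ [x _ <-] [y _ <-]; exists (a *: x + y); rewrite ?linearP.
pose S := linsub_submod (LinSub Slin).
have uS x : u x \in S by rewrite linsubE; apply/asboolP; exists x.
pose v x : subsp S := Sub (u x) (uS x).
have vlin : linear v.
  by move=> a x y; apply/val_inj; rewrite /= linearP.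
pose vl := mk_linear vlin.
have vn x : `|vl x| = `|x| by rewrite -uiso.
have vsurj (y : subsp S) : exists x, vl x = y.
  have := valP y; rewrite linsubE => /asboolP[x _ xy]; exists x.
  exact/val_inj.
have fA := mA.1.
have [B [w [[wbij wo wi] wdist]]] := EX e e0 S (finite_dim_image vsurj fA).
pose t : {linear A -> subsp B} := w \o vl.
have tbij : bijective t.
  apply: bij_comp => //; have /choice[g gE] := vsurj.
  have vI : injective vl.
    by move=> x y /(congr1 val) /=; exact: uI.
  by exists g => // x; apply: vI; rewrite gE.
have tiso : isomorphism t /\ (distortion t <= (1 + e)%:E)%E.
  have oE : opnorm t = opnorm w.
    rewrite /opnorm; congr ereal_sup; apply/seteqP.
    split=> [_ [x /= x1 <-]|_ [y /= y1 <-]].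
      by exists (vl x) => //=; rewrite vn.
    have [x xy] := vsurj y; exists x; first by rewrite /= -vn xy.
    by rewrite -xy.
  have iE : inv_opnorm t = inv_opnorm w.
    rewrite /inv_opnorm; congr ereal_sup; apply/seteqP.
    split=> [_ [x /= x1 <-]|_ [y /= y1 <-]].
      by exists (vl x) => //=; rewrite vn.
    have [x xy] := vsurj y; exists x; last by rewrite -vn xy.
    by rewrite -xy in y1.
  by rewrite /isomorphism /distortion oE iE; split => //; split.
exists (subsp B); split.
  have [tI tK] : injective t /\ forall y, exists x, t x = y.
    by have [g gK Kg] := tbij; split; [exact: can_inj gK|move=> y; exists (g y)].
  split; last by exists B; exact: isometric_refl.
  split; first exact: finite_dim_image fA.
  have [_ [x x0]] := mA; exists (t x); apply: contra_neq x0 => tx0.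
  by apply: tI; rewrite tx0 linear0.
have bm : (banach_mazur A (subsp B) <= (1 + e)%:E)%E.
  by apply: le_trans tiso.2; apply: ereal_inf_lbound; exists t => //; exact: tiso.1.
have bm0 : (0 <= banach_mazur A (subsp B))%E.
  apply: le_ereal_inf_tmp => _ [w' _ <-].
  by rewrite mule_ge0 ?opnorm_ge0 ?inv_opnorm_ge0 ?linear0.
(* Without the logarithm, the bound [1 + e] has only to be less than [expR e]. *)
rewrite -(expeRK e%:E) lte_lne ?in_itv/= ?bm0 ?leey ?lee_fin ?expR_ge0//.
by apply: le_lt_trans bm _; rewrite lte_fin expR_gt1Dx// gt_eqF.
Qed.

End minkowski_base_embedding.

Section lspan_embedding.
Context {R : realType} {V W : normedModType R}.

Lemma lspan_lift (u : {linear V -> W}) s :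
  lspan s `<=` range u -> exists s', map u s' = s.
Proof.
elim: s => [|w s IHs] sub; first by exists [::].
have [s' <-] := IHs (fun y sy => sub y (lspan_behead w sy)).
by have [v _ <-] := sub w (lspan_head w s); exists (v :: s').
Qed.

Lemma finite_dim_embedding (u : {linear V -> W}) s :
  injective u -> range u = lspan s -> finite_dim V.
Proof.
move=> uI us.
have [s' s'E] : exists s', map u s' = s by apply: lspan_lift; rewrite us.
apply: (@finite_dim_lspan _ _ s') => x.
have : lspan s (u x) by rewrite -us; exists x.
by rewrite -s'E lspan_map => -[y ys' /uI <-].
Qed.

End lspan_embedding.

Section subsp_val.
Context {R : realType} {V : normedModType R} (S : submodClosed V).

Definition subsp_val (x : subsp S) : V := val x.

Lemma subsp_val_linear : linear subsp_val.
Proof. by move=> a x y; rewrite /subsp_val linearP. Qed.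

HB.instance Definition _ :=
  GRing.isLinear.Build R (subsp S) V *:%R subsp_val subsp_val_linear.

Lemma subsp_val_inj : injective subsp_val.
Proof. exact: val_inj. Qed.

End subsp_val.

(** * Partial isomorphisms as graphs of bounded distortion *)

Section distorted_graphs.
Context {R : realType}.

(* For the graph of an injective u this says |u| |u^-1| <= M; the homogeneous *)
(* form passes to unions of chains, to closures and to transposed graphs.     *)
Definition distorted {V W : normedModType R} (M : R) (G : set (V * W)) : Prop :=
  forall p q, G p -> G q -> `|p.2| * `|q.1| <= M * (`|p.1| * `|q.2|).

Definition transpose {V W : Type} (p : V * W) : W * V := (p.2, p.1).

Lemma transpose_linear (V W : lmodType R) : linear (@transpose V W).
Proof. by []. Qed.

HB.instance Definition _ (V W : lmodType R) := GRing.isLinear.Build R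
  (V * W)%type (W * V)%type *:%R (@transpose V W) (@transpose_linear V W).

Lemma transposeK (V W : Type) : cancel (@transpose V W) transpose.
Proof. by case. Qed.

Lemma transpose_lspan (V W : lmodType R) (s : seq (V * W)) p :
  lspan (map transpose s) (transpose p) <-> lspan s p.
Proof.
rewrite lspan_map; split=> [[q sq /(can_inj (@transposeK _ _)) <-//]|sp].
by exists p.
Qed.

Lemma distorted_transpose (V W : normedModType R) M (G : set (V * W)) :
  distorted M G -> distorted M (transpose @^-1` G).
Proof.
move=> GM p q Gp Gq; have := GM _ _ Gq Gp.
by rewrite mulrC [`|(transpose q).1| * _]mulrC.
Qed.

(** Comparing [(0, y)] with one point [p0] of nonzero first coordinate makes the right side of the
    inequality vanish. *)
Lemma distorted_fun (V W : normedModType R) M (G : set (V * W)) p0 y :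
  distorted M G -> G p0 -> p0.1 != 0 -> G (0, y) -> y = 0.
Proof.
move=> GM Gp0 p00 /GM/(_ Gp0) /=; rewrite normr0 mul0r mulr0 => h.
apply/eqP; rewrite -normr_le0.
by rewrite -(pmulr_lle0 _ (_ : 0 < `|p0.1|)) ?normr_gt0.
Qed.

Lemma distorted_bounded (V W : normedModType R) M (G : set (V * W)) p0 :
  distorted M G -> G p0 -> p0.1 != 0 ->
  forall p, G p -> `|p.2| <= M * `|p0.2| / `|p0.1| * `|p.1|.
Proof.
move=> GM Gp0 p01 p Gp.
have := GM _ _ Gp Gp0; rewrite -ler_pdivlMr ?normr_gt0// => /le_trans; apply.
by lra.
Qed.

End distorted_graphs.

(** * Adding one vector to the domain and to the range *)

Section extension_step.
Context {R : realType} {X E : completeNormedModType R}.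
Hypothesis EX : finitely_representable E X.
Hypothesis aud : almost_universal_disposition E (minkowski_base X).

(** The graph is that of an embedding [i] of the old domain; almost universal disposition extends
    [i] to the span of the old domain and [x], and [y] is the image of [x]. *)
Lemma extend_domain (s : seq (E * E)) M p0 e x :
  lspan s p0 -> p0.1 != 0 -> p0.2 != 0 -> 0 < e -> distorted M (lspan s) ->
  exists y, distorted ((1 + e) * M) (lspan ((x, y) :: s)).
Proof.
move=> sp0 p01 p02 e0 sM.
pose f : seq E := map fst s.
have fE : lspan f = fst @` lspan s by exact: lspan_map.
pose H := linsub_submod (LinSub (lspan_linear (x :: f))).
(* Almost universal disposition speaks of subspaces of a given space, so the old domain is recast as
   a subspace of [subsp H]. *)
have AP : linear_set [set z : subsp H | lspan f (val z)].
  have [f0 fP] := lspan_linear f.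
  by split=> [|a z z' fz fz']; [exact: f0|exact: fP].
pose A := linsub_submod (LinSub AP).
pose valA : {linear subsp A -> E} := @subsp_val _ _ H \o @subsp_val _ _ A.
have valA_inj : injective valA by move=> z z' /subsp_val_inj/subsp_val_inj.
have HE (z : E) : lspan (x :: f) z -> {h : subsp H | subsp_val h = z}.
  by move=> hz; exists (Sub z (asboolT hz)).
have AE (z : E) : lspan f z -> {a : subsp A | valA a = z}.
  move=> fz; have [h hz] := HE z (lspan_behead _ fz).
  have hA : lspan f (val h) by move: fz; rewrite -hz.
  by exists (Sub h (asboolT hA)).
have valA_in (z : subsp A) : lspan f (valA z) by exact: (asboolW (valP z)).
have valH_in (h : subsp H) : lspan (x :: f) (subsp_val h).
  exact: (asboolW (valP h)).
have [z0 z0E] := AE p0.1 ltac:(by rewrite fE; exists p0).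
have z00 : z0 != 0 by apply: contra_neq p01 => z00; rewrite -z0E z00 linear0.
have KA : minkowski_base X (subsp A).
  apply: (@minkowski_base_embedding _ X E _ valA) => //.
  split; last by exists z0.
  apply: (@finite_dim_embedding _ _ _ valA f) => //.
  by apply/seteqP; split=> [_ [a _ <-]//|z /AE[a <-]]; exists a.
have KB : minkowski_base X (subsp H).
  apply: (@minkowski_base_embedding _ X E _ (@subsp_val _ _ H)) => //.
  split.
    apply: (@finite_dim_embedding _ _ _ (@subsp_val _ _ H) (x :: f)).
      exact: subsp_val_inj.
    apply/seteqP; split=> [_ [a _ <-]|z /HE[a <-]]; last by exists a.
    exact: valH_in.
  exists (subsp_val z0); apply: contra_neq z00 => v0.
  by apply: subsp_val_inj; rewrite v0 linear0.
have [|y|z|i iE] := @linear_of_graph _ (subsp A) E [set p | lspan s (valA p.1, p.2)].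
- have [s0 sP] := lspan_linear s; split=> [|a p q sp sq].
    by rewrite /= linear0; exact: s0.
  by rewrite /= linearP; exact: sP sp sq.
- by rewrite /= linear0; exact: (distorted_fun sM sp0).
- by have := valA_in z; rewrite fE => -[[v y] sy /= vE]; exists y; rewrite /= -vE.
have i_fun z y : lspan s (valA z, y) -> i z = y.
  move=> szy; apply/eqP; rewrite -subr_eq0; apply/eqP.
  apply: (distorted_fun sM sp0 p01).
  have := linear_setB (lspan_linear s) (iE z) szy.
  rewrite (_ : _ - _ = (0, i z - y))//.
  by congr pair; rewrite /= subrr.
have iz0 : i z0 = p0.2 by apply: i_fun; rewrite z0E -surjective_pairing.
have [||a [b [a0 b0 abM ia ib]]] := @bounds_of_distortion _ _ _ i M z0 z00.
- by rewrite iz0.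
- by move=> z z'; exact: sM (iE z) (iE z').
have [io ii iab] := bounded_distortion a0 b0 ia ib.
have iI : injective i.
  move=> z z' zz'; apply/eqP; rewrite -subr_eq0 -normr_le0.
  by rewrite (le_trans (ib _))// linearB zz' subrr normr0 mulr0.
have [j [jiso jA jM]] := aud KB KA e0 (And3 iI io ii).
have {}jM : (distortion j <= ((1 + e) * M)%:E)%E.
  apply: le_trans jM _; rewrite EFinM; apply: lee_wpmul2l.
    by rewrite lee_fin addr_ge0// ltW.
  by apply: le_trans iab _; rewrite lee_fin.
have {}jM := distortion_bound jiso jM.
have [hx hxE] := HE x (lspan_head x f).
exists (j hx).
have jE p : lspan ((x, j hx) :: s) p -> exists h, subsp_val h = p.1 /\ j h = p.2.
  move=> [c [q [sq ->]]].
  have [z zE] := AE q.1 ltac:(by rewrite fE; exists q).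
  exists (c *: hx + subsp_val z); split.
    by rewrite linearP -[RHS]/(c *: x + q.1) -zE -[in RHS]hxE.
  by rewrite linearP jA (i_fun z q.2)// zE -surjective_pairing.
by move=> p q /jE[h [<- <-]] /jE[h' [<- <-]]; exact: jM.
Qed.

Lemma extend_both (s : seq (E * E)) M K p0 x :
  lspan s p0 -> p0.1 != 0 -> p0.2 != 0 -> 0 < M -> M < K ->
  distorted M (lspan s) ->
  exists s', (exists M', [/\ 0 < M', M' < K & distorted M' (lspan s')]) /\
    [/\ lspan s `<=` lspan s', (exists y, lspan s' (x, y))
    & (exists y, lspan s' (y, x))].
Proof.
have grow N : 0 < N -> N < K -> exists2 e, 0 < e & 0 < (1 + e) * N < K.
  move=> N0 NK; exists ((K - N) / (N *+ 2)).
    by rewrite divr_gt0 ?subr_gt0// mulrn_wgt0.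
  have -> : (1 + (K - N) / (N *+ 2)) * N = (N + K) / 2.
    by field; rewrite gt_eqF.
  lra.
move=> sp0 p01 p02 M0 MK sM.
have [e e0 /andP[N0 NK]] := grow M M0 MK.
have [y yM] := extend_domain x sp0 p01 p02 e0 sM.
set s1 := (x, y) :: s in yM.
have s1p0 : lspan s1 p0 := lspan_behead _ sp0.
have [d d0 /andP[N0' NK']] := grow _ N0 NK.
have s1M' : distorted ((1 + e) * M) (lspan (map transpose s1)).
  move=> p q; rewrite -[p]transposeK -[q]transposeK !transpose_lspan => sp sq.
  exact: (distorted_transpose yM).
have [z zM] := @extend_domain (map transpose s1) _ (transpose p0) d x
  (iffRL (transpose_lspan _ _) s1p0) p02 p01 d0 s1M'.
exists ((z, x) :: s1); split.
  exists ((1 + d) * ((1 + e) * M)); split=> // p q.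
  move=> /transpose_lspan sp /transpose_lspan sq.
  exact: (distorted_transpose zM sp sq).
split.
- by move=> p sp; do 2!apply: lspan_behead.
- by exists y; apply: lspan_behead; exact: lspan_head.
- by exists z; exact: lspan_head.
Qed.

End extension_step.

(** * Sequential closures of graphs *)

Section graph_closure.
Context {R : realType}.

Definition graph_closure {V W : normedModType R} (G : set (V * W)) :
    set (V * W) :=
  [set p | exists u : nat -> V * W, [/\ forall n, G (u n),
    (fun n => (u n).1) @ \oo --> p.1 & (fun n => (u n).2) @ \oo --> p.2]].

Lemma sub_graph_closure (V W : normedModType R) (G : set (V * W)) :
  G `<=` graph_closure G.
Proof. by move=> p Gp; exists (fun=> p); split => //; exact: cvg_cst. Qed.

Lemma graph_closure_linear (V W : normedModType R) (G : set (V * W)) :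
  linear_set G -> linear_set (graph_closure G).
Proof.
move=> [G0 GP]; split; first exact: sub_graph_closure.
move=> a p q [u [Gu u1 u2]] [v [Gv v1 v2]].
exists (fun n => a *: u n + v n); split => /=; first by move=> n; exact: GP.
  by apply: cvgD => //; exact: cvgZl_tmp.
by apply: cvgD => //; exact: cvgZl_tmp.
Qed.

Lemma graph_closure_transpose (V W : normedModType R) (G : set (V * W)) p :
  graph_closure (transpose @^-1` G) p -> graph_closure G (transpose p).
Proof. by move=> [u [Gu u1 u2]]; exists (fun n => transpose (u n)). Qed.

Lemma distorted_closure (V W : normedModType R) M (G : set (V * W)) :
  distorted M G -> distorted M (graph_closure G).
Proof.
move=> GM p q [u [Gu u1 u2]] [v [Gv v1 v2]].
have lhs : (fun n => `|(u n).2| * `|(v n).1|) @ \oo --> `|p.2| * `|q.1|.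
  by apply: cvgM; exact: cvg_norm.
have rhs : (fun n => M * (`|(u n).1| * `|(v n).2|)) @ \oo -->
    M * (`|p.1| * `|q.2|).
  by apply: cvgM; [exact: cvg_cst|apply: cvgM; exact: cvg_norm].
by apply: ler_cvg_to lhs rhs _; apply: nearW => n; exact: GM.
Qed.

(** Along a sequence of [G] whose first coordinates converge to [x], the bound makes the second
    coordinates Cauchy, and [W] is complete. *)
Lemma graph_closure_total (V : normedModType R) (W : completeNormedModType R)
    (G : set (V * W)) (C : R) :
  linear_set G -> (forall p, G p -> `|p.2| <= C * `|p.1|) ->
  (forall x e, 0 < e -> exists2 p, G p & `|x - p.1| < e) ->
  forall x, exists y, graph_closure G (x, y).
Proof.
move=> Gl GC Gdense x.
have /choice[u uP] : forall n : nat, exists p, G p /\ `|x - p.1| < n.+1%:R^-1.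
  by move=> n; have [|p Gp xp] := Gdense x n.+1%:R^-1; [rewrite invr_gt0|exists p].
have u1 : (fun n => (u n).1) @ \oo --> x.
  apply/cvgrPdist_lt => e e0; near=> n.
  apply: lt_trans (uP n).2 _; near: n.
  exact: near_infty_natSinv_lt (PosNum e0).
have u2 : cvgn (fun n => (u n).2).
  apply: cauchy_cvg; apply/cauchy_ballP => e e0.
  (* Nothing says that [C] is positive; the maximum with 1 can be divided by. *)
  have C1 : 0 < Num.max C 1 by rewrite lt_max ltr01 orbT.
  have e'0 : 0 < e / Num.max C 1 by rewrite divr_gt0.
  have /cvg_cauchy/cauchy_ballP/(_ _ e'0) [[P Q] [/= FP FQ] PQ] := cvgP _ u1.
  exists ((fun n => (u n).2) @` ((fun n => (u n).1) @^-1` P),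
          (fun n => (u n).2) @` ((fun n => (u n).1) @^-1` Q)).
    split.
      by apply: (@filterS _ \oo _ ((fun n => (u n).1) @^-1` P)) => // n; exists n.
    by apply: (@filterS _ \oo _ ((fun n => (u n).1) @^-1` Q)) => // n; exists n.
  move=> [_ _] [/= [n Pn <-] [m Qm <-]].
  have := PQ ((u n).1, (u m).1) (conj Pn Qm).
  rewrite -!ball_normE/= ltr_pdivlMr// => h; apply: le_lt_trans h.
  have := GC _ (linear_setB Gl (uP n).1 (uP m).1) => /= /le_trans; apply.
  by rewrite mulrC ler_wpM2l// le_max lexx.
exists (lim ((fun n => (u n).2) @ \oo)), u; split => //.
by move=> n; case: (uP n).
Unshelve. all: by end_near.
Qed.

End graph_closure.

(** * The limit automorphism and the back-and-forth *)

Section automorphism.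
Context {R : realType} {E : completeNormedModType R}.

(** The closure of [G] is still [distorted], hence single-valued; it is total because the domain is
    dense, and onto by the same argument for the transposed graph. *)
Lemma automorphism_of_dense_graph (G : set (E * E)) M p0 :
  linear_set G -> distorted M G -> G p0 -> p0.1 != 0 -> p0.2 != 0 ->
  (forall x e, 0 < e -> exists2 p, G p & `|x - p.1| < e) ->
  (forall x e, 0 < e -> exists2 p, G p & `|x - p.2| < e) ->
  exists T : {linear E -> E}, [/\ bijective T, forall p, G p -> T p.1 = p.2
    & exists a b, [/\ 0 <= a, 0 <= b, a * b <= M,
        forall x, `|T x| <= a * `|x| & forall x, `|x| <= b * `|T x|]].
Proof.
move=> Gl GM Gp0 p01 p02 Gdom Gran.
have Cl := graph_closure_linear Gl.
have CM := distorted_closure GM.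
have Cp0 := sub_graph_closure Gp0.
have Ctot := graph_closure_total Gl (distorted_bounded GM Gp0 p01) Gdom.
have Csurj y : exists x, graph_closure G (x, y).
  have Gt0 : (transpose @^-1` G) (transpose p0) by rewrite /preimage/= transposeK.
  have [|x e e0|x xP] := graph_closure_total _
    (distorted_bounded (distorted_transpose GM) Gt0 p02) _ y.
  - have [G0 GP] := Gl; split=> [|a p q Gp Gq]; first exact: G0.
    exact: GP Gp Gq.
  - have [p Gp xp] := Gran x e e0; exists (transpose p) => //.
    by rewrite /preimage/= transposeK.
  by exists x; exact: graph_closure_transpose xP.
have [||T TC] := linear_of_graph Cl.
- by move=> y; exact: distorted_fun CM Cp0 p01.
- exact: Ctot.
have T_fun x y : graph_closure G (x, y) -> T x = y.
  move=> Cxy; apply/eqP; rewrite -subr_eq0; apply/eqP.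
  apply: (distorted_fun CM Cp0 p01).
  have := linear_setB Cl (TC x) Cxy.
  by congr (graph_closure G _); congr pair; rewrite /= subrr.
have TG p : G p -> T p.1 = p.2.
  by move=> Gp; apply: T_fun; rewrite -surjective_pairing; exact: sub_graph_closure.
have [||a [b [a0 b0 abM Ta Tb]]] := @bounds_of_distortion _ _ _ T M p0.1 p01.
- by rewrite TG.
- by move=> x x'; exact: CM (TC x) (TC x').
exists T; split => //; last by exists a, b.
have /choice[S SP] := Csurj.
have TS : cancel S T by move=> y; exact: T_fun.
exists S => // x; apply/eqP; rewrite -subr_eq0 -normr_le0.
by rewrite (le_trans (Tb _))// linearB TS subrr normr0 mulr0.
Qed.

Lemma separable_dense_seq (V : normedModType R) : separable V ->
  exists d : nat -> V, forall x e, 0 < e -> exists n, `|x - d n| < e.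
Proof.
move=> [D [/countable_injP[f fI] Dd]].
(* The sequence inverts the injection [f] of [D] into the naturals, with 0 at the indices that [f]
   misses. *)
have /choice[d dP] : forall n, exists x, forall y, D y -> f y = n -> y = x.
  move=> n; have [[x [Dx fx]]|h] := pselect (exists x, D x /\ f x = n).
    by exists x => y Dy fy; apply: fI; rewrite ?inE// fy.
  by exists 0 => y Dy fy; exfalso; apply: h; exists y.
exists d => x e e0.
have [|y [xy Dy]] := Dd (ball x e) _ (ball_open x e).
  by exists x; exact: ballxx.
by exists (f y); rewrite -(dP _ _ Dy erefl); move: xy; rewrite -ball_normE.
Qed.

Lemma back_and_forth (X : completeNormedModType R) (s : seq (E * E)) p0 (K : R) :
  finitely_representable E X -> separable E ->
  almost_universal_disposition E (minkowski_base X) ->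
  1 < K -> lspan s p0 -> p0 != 0 ->
  (forall p, lspan s p -> `|p.1| = `|p.2|) ->
  exists T : {linear E -> E}, [/\ bijective T, forall p, lspan s p -> T p.1 = p.2
    & exists a b, [/\ 0 <= a, 0 <= b, a * b <= K,
        forall x, `|T x| <= a * `|x| & forall x, `|x| <= b * `|T x|]].
Proof.
move=> EX /separable_dense_seq[d dP] aud K1 sp0 p00 siso.
have p01 : p0.1 != 0.
  apply: contra_neq p00 => p01; rewrite (surjective_pairing p0) p01.
  by have /eqP := siso _ sp0; rewrite p01 normr0 eq_sym normr_eq0 => /eqP ->.
have p02 : p0.2 != 0 by rewrite -normr_eq0 -siso// normr_eq0.
(* The strict inequality [M < K] is the invariant that lets every step enlarge the distortion a
   little. *)
pose good (t : seq (E * E)) := lspan t p0 /\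
  exists M, [/\ 0 < M, M < K & distorted M (lspan t)].
pose adds n t t' := [/\ lspan t `<=` lspan t',
  (exists y, lspan t' (d n, y)) & (exists y, lspan t' (y, d n))].
have /choice[step stepP] : forall nt : nat * seq (E * E), exists t',
    good nt.2 -> good t' /\ adds nt.1 nt.2 t'.
  move=> [n t]; have [[tp0 [M [M0 MK tM]]]|h] := pselect (good t); last first.
    by exists t.
  have [t' [[M' t'M'] [tt' t1 t2]]] :=
    extend_both EX aud (d n) tp0 p01 p02 M0 MK tM.
  by exists t' => _; split => //; split; [exact: tt'|exists M'].
pose t := fix t n := if n is m.+1 then step (m, t m) else s.
have tgood n : good (t n).
  elim: n => [|n IHn]; last by case: (stepP (n, t n) IHn).
  (* The initial graph is isometric, so it has distortion constant 1, less than [K]. *)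
  split => //; exists 1; split => // p q sp sq.
  by rewrite mul1r (siso _ sp) (siso _ sq).
have tadds n : adds n (t n) (t n.+1) by case: (stepP (n, t n) (tgood n)).
have tmono m n : (m <= n)%N -> lspan (t m) `<=` lspan (t n).
  move=> /subnK <-; elim: (n - m)%N => [//|k IHk] p /IHk.
  by case: (tadds (k + m)%N) => h _ _; exact: h.
pose G := \bigcup_n lspan (t n).
have G2 p q : G p -> G q -> exists n, lspan (t n) p /\ lspan (t n) q.
  move=> [m _ mp] [n _ nq]; exists (maxn m n).
  by split; [apply: tmono mp|apply: tmono nq]; rewrite ?leq_maxl ?leq_maxr.
have sG : lspan s `<=` G by move=> p sp; exists 0%N.
have [|||||||T [Tbij TG Tab]] := @automorphism_of_dense_graph G K p0.
- split; first by apply: sG; case: (lspan_linear s).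
  move=> a p q Gp Gq; have [n [np nq]] := G2 _ _ Gp Gq.
  by exists n => //; have [_] := lspan_linear (t n); apply.
- move=> p q Gp Gq; have [n [np nq]] := G2 _ _ Gp Gq.
  have [_ [M [_ MK tM]]] := tgood n.
  apply: le_trans (tM _ _ np nq) _.
  by rewrite ler_wpM2r ?mulr_ge0// ltW.
- exact: sG.
- by [].
- by [].
- move=> x e /(dP x)[n xn]; have [_ [y ny] _] := tadds n.
  by exists (d n, y) => //; exists n.+1.
- move=> x e /(dP x)[n xn]; have [_ _ [y ny]] := tadds n.
  by exists (y, d n) => //; exists n.+1.
by exists T; split => // p sp; apply: TG; exact: sG.
Qed.

End automorphism.

(** * Functionals and adjoints *)

Section dual_maps.
Context {R : realType}.
Implicit Types V W : normedModType R.

Lemma mk_dual V (f : {linear V -> R^o}) (C : R) :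
  (forall x, `|f x| <= C * `|x|) -> exists F : dual V, forall x, dual_fun F x = f x.
Proof.
move=> fC; have fd : (f : V -> R^o) \in @dual_pred R V.
  rewrite inE/=; split; first exact: linearP.
  by apply/(opnorm_ltyP (linearP f)); exists C.
by exists (exist _ (f : V -> R^o) fd).
Qed.

Lemma dual_eval_linear V (x : V) : linear (fun f : dual V => dual_fun f x : R^o).
Proof. by []. Qed.

Lemma dual_ext V (f g : dual V) : (forall x, dual_fun f x = dual_fun g x) -> f = g.
Proof. by move=> fg; apply/val_inj/funext. Qed.

Lemma adjoint_exists V W (T : {linear V -> W}) (a : R) :
  (forall x, `|T x| <= a * `|x|) ->
  exists T' : {linear dual W -> dual V},
    forall f x, dual_fun (T' f) x = dual_fun f (T x).
Proof.
move=> Ta.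
have /choice[t tE] : forall f : dual W, exists F : dual V,
    forall x, dual_fun F x = dual_fun f (T x).
  move=> f; have lf : linear (fun x => dual_fun f (T x) : R^o).
    by move=> c x y; rewrite !linearP.
  apply: (@mk_dual _ (mk_linear lf) (dual_norm f * a)) => x.
  rewrite (le_trans (dual_norm_le _ _))// -mulrA ler_wpM2l//.
  exact: dual_norm_ge0.
have tl : linear t.
  move=> c f g; apply: dual_ext => x.
  by rewrite tE -[RHS]/(c *: dual_fun (t f) x + dual_fun (t g) x) !tE.
by exists (mk_linear tl).
Qed.

(** Composition with the inverse [S] of [T] inverts the adjoint, and both bounds carry over with the
    same constants. *)
Lemma adjoint_automorphism V (T : {linear V -> V}) (a b : R) :
  bijective T -> 0 <= a -> 0 <= b ->
  (forall x, `|T x| <= a * `|x|) -> (forall x, `|x| <= b * `|T x|) ->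
  exists I : {linear dual V -> dual V}, [/\ isomorphism I,
    (distortion I <= (a * b)%:E)%E
    & forall f x, dual_fun (I f) x = dual_fun f (T x)].
Proof.
move=> [S TK SK] a0 b0 Ta Tb.
have Sl : linear S.
  by move=> c x y; apply: (can_inj TK); rewrite linearP !SK.
have [I IE] := adjoint_exists Ta.
have [J JE] : exists J : {linear dual V -> dual V},
    forall f x, dual_fun (J f) x = dual_fun f (S x).
  by apply: (@adjoint_exists _ _ (mk_linear Sl) b) => x; rewrite -{2}[x]SK Tb.
have Ia f : `|I f| <= a * `|f|.
  apply/dual_norm_leP; first by rewrite mulr_ge0.
  move=> x; rewrite IE (le_trans (dual_norm_le _ _))//.
  by rewrite -mulrA mulrCA ler_wpM2l// dual_norm_ge0.
have Ib f : `|f| <= b * `|I f|.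
  apply/dual_norm_leP; first by rewrite mulr_ge0.
  move=> x; rewrite -[x]SK -IE (le_trans (dual_norm_le _ _))//.
  by rewrite -mulrA mulrCA ler_wpM2l// dual_norm_ge0.
have [Io Ii Id] := bounded_distortion a0 b0 Ia Ib.
exists I; split => //; split => //; exists J => f; apply: dual_ext => x.
  by rewrite JE IE SK.
by rewrite IE JE TK.
Qed.

End dual_maps.

(** * Quotients of the dual and annihilators in the reflexive space *)

Section dual_quotients.
Context {R : realType}.

(** Take [f] norming [a]: a nearly minimal representative [g] of its class [q] has norm barely above
    1 and satisfies [|a| = g b]. *)
Lemma dual_pairing_le (V : normedModType R) (Z : closedSubmod (dual V)) (a b : V) :
  (forall f : dual V, exists q : quotsp Z, `|q| <= `|f| /\
    forall g, quot_map Z g = q -> dual_fun f a = dual_fun g b) ->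
  `|a| <= `|b|.
Proof.
move=> H; have [f [fa f1]] := norming_functional a.
have {}f1 : `|f| <= 1 by apply/dual_norm_leP => // x; rewrite mul1r.
have [q [qf qE]] := H f.
apply/ler_addgt0Pr => e e0.
have b1 : 0 < `|b| + 1 by rewrite ltr_wpDl.
have [g gq ge] := quot_norm_adherent q (divr_gt0 e0 b1).
rewrite -fa (qE _ gq) (le_trans (ler_norm _))// (le_trans (dual_norm_le _ _))//.
have {}ge : dual_norm g <= 1 + e / (`|b| + 1).
  by apply: (le_trans (ltW ge)); rewrite lerD2r (le_trans qf).
apply: le_trans (ler_wpM2r _ ge) _ => //.
rewrite mulrDl mul1r lerD2l -mulrA ler_piMr// ?(ltW e0)//.
by rewrite mulrC ler_pdivrMr// mul1r lerDl.
Qed.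

Variables (E : completeNormedModType R) (Erefl : reflexive_space E).

(** A functional norming the class of [h] modulo [Z], pulled back to [dual E], is by reflexivity
    evaluation at some [b]. This [b] is killed by [Z], hence by [h], so the class of [h] has norm
    0. *)
Lemma bipolar (Z : closedSubmod (dual E)) (h : dual E) :
  (forall b, (forall g, g \in Z -> dual_fun g b = 0) -> dual_fun h b = 0) ->
  h \in Z.
Proof.
move=> hZ; have [psi [psih psi1]] := norming_functional (quot_map Z h).
have pl : linear (fun f => dual_fun psi (quot_map Z f) : R^o).
  by move=> c f g; rewrite !linearP.
have [|phi phiE] := @mk_dual R (dual E) (mk_linear pl) 1.
  by move=> f; rewrite mul1r (le_trans (psi1 _))// quot_norm_le.
have [b bE] := Erefl phi.
have hb : dual_fun h b = 0.
  apply: hZ => g gZ; rewrite -bE phiE /= (_ : quot_map Z g = 0) ?linear0//.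
  by rewrite -(linear0 (quot_map Z)); apply/quot_mapP; rewrite subr0.
have : quot_map Z h = 0.
  by apply/eqP; rewrite -normr_eq0 -psih -[X in X == _]phiE bE hb.
by rewrite -(linear0 (quot_map Z)) => /quot_mapP; rewrite subr0.
Qed.

Variables (Y Z : closedSubmod (dual E)) (i : {linear quotsp Y -> quotsp Z}).
Hypothesis i_iso : Defs.isometry i.

(* Taking g = 0, resp. f = 0, shows that p.2 and p.1 lie in the annihilators  *)
(* of Y and Z: this is the graph of the isometry whose adjoint is i.          *)
Definition predual_graph : set (E * E) :=
  [set p | forall f g, i (quot_map Y f) = quot_map Z g ->
    dual_fun f p.2 = dual_fun g p.1].

Lemma predual_graph_linear : linear_set predual_graph.
Proof.
split=> [f g _|c p q Gp Gq f g fg]; first by rewrite !linear0.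
rewrite -[LHS]/(dual_fun f (c *: p.2 + q.2)).
by rewrite -[RHS]/(dual_fun g (c *: p.1 + q.1)) !linearP /= (Gp _ _ fg) (Gq _ _ fg).
Qed.

(** Each inequality is [dual_pairing_le], with classes carried by the inverse of [i] for one and by
    [i] for the other. *)
Lemma predual_graph_norm p : predual_graph p -> `|p.1| = `|p.2|.
Proof.
move=> Gp; have [[j ij ji] inorm] := i_iso.
apply/eqP; rewrite eq_le; apply/andP; split.
  apply: (@dual_pairing_le E Y) => g; exists (j (quot_map Z g)); split.
    by rewrite -inorm ji; exact: quot_norm_le.
  by move=> f fE; rewrite (Gp f g)// fE ji.
apply: (@dual_pairing_le E Z) => f; exists (i (quot_map Y f)); split.
  by rewrite inorm; exact: quot_norm_le.
by move=> g gE; exact: Gp.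
Qed.

(** Since [Z] kills [b], sending [f] to [g b], for any [g] in the class [i [f]], is a well-defined
    functional on [dual E]; reflexivity represents it by the partner [a] of [b]. *)
Lemma predual_graph_total b :
  (forall g, g \in Z -> dual_fun g b = 0) -> exists a, predual_graph (b, a).
Proof.
move=> bZ.
have b_ext g g' : quot_map Z g = quot_map Z g' -> dual_fun g b = dual_fun g' b.
  by move/quot_mapP/bZ => gg'; apply/eqP; rewrite -subr_eq0; exact/eqP.
have [|t|f|phi phiE] := @linear_of_graph R (dual E) R^o
  [set p | exists2 g, i (quot_map Y p.1) = quot_map Z g & dual_fun g b = p.2].
- split=> [|c p q [g gE gb] [h hE hb]]; first by exists 0; rewrite ?linear0.
  exists (c *: g + h); first by rewrite /= !linearP gE hE.
  by rewrite -[RHS]/(c *: p.2 + q.2) -gb -hb.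
- move=> [g /= gE <-]; rewrite -(b_ext 0)// linear0.
  by rewrite -gE !linear0.
- by have [g gE] := quot_map_surj (i (quot_map Y f)); exists (dual_fun g b), g.
(* The class [i [f]] has norm at most [|f|]; a slack of [|f|] in choosing its representative gives
   the factor 2. *)
have [|Phi PhiE] := @mk_dual R (dual E) phi (2 * `|b|).
  move=> f; have [->|f0] := eqVneq f 0; first by rewrite linear0 !normr0 mulr0.
  have nf : 0 < `|f| by rewrite normr_gt0.
  have [g /= gE <-] := phiE f.
  have [h hE hf] := quot_norm_adherent (i (quot_map Y f)) nf.
  rewrite (b_ext g h); last by rewrite hE.
  rewrite (le_trans (dual_norm_le _ _))// mulrAC ler_wpM2r//.
  apply: (le_trans (ltW hf)).
  have -> : quot_norm (i (quot_map Y f)) = quot_norm (quot_map Y f).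
    by have [_ inorm] := i_iso; exact: inorm.
  by rewrite mulrDl mul1r lerD2r quot_norm_le.
have [a aE] := Erefl Phi.
exists a => f g fg /=; rewrite -aE PhiE.
by have [h /= hE <-] := phiE f; apply: b_ext; rewrite -hE.
Qed.

(** Lifts [g k] of a spanning family of the quotient separate the points of the graph: every
    functional is a combination of them modulo [Z], and [Z] kills first coordinates. *)
Lemma predual_graph_spanned : finite_dim (quotsp Z) ->
  exists s, lspan s = predual_graph.
Proof.
move=> [n [e eP]].
have /choice[g gE] := fun k => quot_map_surj (e k).
apply: (@lspan_of_functionals _ _ 'I_n (enum 'I_n)
  (fun k p => dual_fun (g k) p.1)).
- by move=> k c p q; rewrite /= linearP.
- exact: predual_graph_linear.
move=> p Gp gp.
have p1 : p.1 = 0.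
  have [h [hp _]] := norming_functional p.1.
  have [c cE] := eP (quot_map Z h).
  have hk : quot_map Z (h - \sum_k c k *: g k) = 0.
    rewrite linearB linear_sum /= cE; apply/eqP; rewrite subr_eq0; apply/eqP.
    by apply: eq_bigr => k _; rewrite linearZ /= gE.
  have := Gp 0 (h - \sum_k c k *: g k).
  rewrite hk !linear0 => /(_ erefl) /esym.
  rewrite -[dual_fun (_ - _) _]/(dual_fun h p.1 -
    mk_linear (dual_eval_linear p.1) (\sum_k c k *: g k)).
  rewrite linear_sum big1 ?subr0; last first.
    by move=> k _; rewrite linearZ /= gp ?mem_enum// scaler0.
  by rewrite hp => /eqP; rewrite -[X in _ == X]/(0 : R) normr_eq0 => /eqP.
have /eqP := predual_graph_norm Gp; rewrite p1 normr0 eq_sym normr_eq0 => /eqP p2.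
by rewrite (surjective_pairing p) p1 p2.
Qed.

End dual_quotients.

Theorem proposition2 (R : realType) (X E : completeNormedModType R)
    (hclosed : starstar_closed X)
    (hsr : superreflexive X)
    (hE : fclass X E)
    (hsep : separable E)
    (haud : almost_universal_disposition E (minkowski_base X)) :
  almost_cohomogeneous (dual E).
Proof.
move=> e Y Z e0 _ Zfin i i_iso.
have Erefl := hsr E hE.
have EX : finitely_representable E X by case: hE.
have [s sE] := predual_graph_spanned i_iso Zfin.
have [T [Tbij Ts [a [b [a0 b0 abe Ta Tb]]]]] :
    exists T : {linear E -> E}, [/\ bijective T,
      forall p, lspan s p -> T p.1 = p.2
    & exists a b, [/\ 0 <= a, 0 <= b, a * b <= 1 + e,
        forall x, `|T x| <= a * `|x| & forall x, `|x| <= b * `|T x|]].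
  have siso p : lspan s p -> `|p.1| = `|p.2|.
    by rewrite sE; exact: predual_graph_norm.
  have [[p0 [sp0 p00]]|s0] := pselect (exists p0, lspan s p0 /\ p0 != 0).
    by apply: (back_and_forth EX hsep haud _ sp0 p00 siso); rewrite ltrDl.
  (* Here the graph is reduced to 0, so there is no nonzero point to start from, and the identity
     extends it. *)
  exists (@idfun E : {linear E -> E}); split; first by exists id.
    move=> p sp; apply/eqP; apply: contra_notT s0 => p12; exists p; split=> //.
    by apply: contra_neq p12 => ->.
  exists 1, 1; rewrite mul1r lerDl (ltW e0) ler01.
  by split => // x; rewrite mul1r.
have [I [Iiso Idist IE]] := adjoint_automorphism Tbij a0 b0 Ta Tb.
exists I; split => //; first by apply: le_trans Idist _; rewrite lee_fin.
move=> f; have [g gE] := quot_map_surj (i (quot_map Y f)).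
(* It remains to see that [g - I f] vanishes at each [c] annihilated by [Z]; there [T c] is the
   partner [d] of [c], and [f d = g c] by definition of the graph. *)
rewrite -gE; apply/quot_mapP; apply: (bipolar Erefl) => c cZ.
have [d cd] := predual_graph_total Erefl i_iso cZ.
have Tc : T c = d by apply: (Ts (c, d)); rewrite sE.
rewrite -[LHS]/(dual_fun g c - dual_fun (I f) c) IE Tc.
by rewrite (cd f g)// subrr.
Qed.
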